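(* Let $(v,P)$ be a smooth solution, with $v$ bounded, of the stationary Navier--Stokes problem $$(v\cdot\nabla)v+\nabla P-\Delta v=0,\qquad \nabla\cdot v=0\qquad\text{in }\mathbb{R}^2\times\mathbb{S},$$ $$v(x_h,x_3)=v(x_h,x_3+1),$$ with finite Dirichlet integral $$\int_{\mathbb{R}^2\times\mathbb{S}}|\nabla v(x)|^2\,dx<+\infty .$$ If the angular component $v^\theta$ is axially symmetric (i.e. independent of $\theta$), while no symmetry is assumed on $v^r$ and $v^3$, then $v\equiv c\,e_3$ for some constant $c\in\mathbb{R}$.
   Context: Points are $x=(x_h,x_3)$ with $x_h=(x_1,x_2)\in\mathbb{R}^2$. $\mathbb{S}$ is the one-dimensional periodic domain of period $1$; functions on $\mathbb{R}^2\times\mathbb{S}$ (both $v$ and $P$) are functions that are $1$-periodic in $x_3$, and integrals over $\mathbb{R}^2\times\mathbb{S}$ are over one period in $x_3$. Here $v:\mathbb{R}^2\times\mathbb{S}\to\mathbb{R}^3$ is the velocity and $P$ is the scalar pressure. Cylindrical coordinates: $r=\sqrt{x_1^2+x_2^2}$, $\theta=\arctan(x_2/x_1)$, $e_r=(x_1/r,x_2/r,0)$, $e_\theta=(-x_2/r,x_1/r,0)$, $e_3=(0,0,1)$, and $v=v^re_r+v^\theta e_\theta+v^3e_3$, where a priori each component may depend on $(r,\theta,x_3)$. *)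

(* Defs.v *)
From HB Require Import structures.
From mathcomp Require Import all_boot all_order all_algebra.
From mathcomp Require Import all_classical all_reals all_analysis.

Set Implicit Arguments.
Unset Strict Implicit.
Unset Printing Implicit Defensive.

Import Order.TTheory GRing.Theory Num.Theory.
Import numFieldNormedType.Exports.

Local Open Scope classical_set_scope.
Local Open Scope ring_scope.

(* Coordinates are 0-based: (x_1, x_2, x_3) is (x 0 0, x 0 1, x 0 2), the
   column indices being elements of the ring 'I_3.  A function on R^2 x S is a
   function on R^3 that is 1-periodic in x_3. *)

Definition point3 (R : realType) (a b c : R) : 'rV[R]_3 :=
  \row_(i < 3) [:: a; b; c]`_i.

Definition basis3 (R : realType) (i : 'I_3) : 'rV[R]_3 := delta_mx 0 i.

Definition partial (R : realType) (W : normedModType R) (i : 'I_3)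
    (f : 'rV[R]_3 -> W) : 'rV[R]_3 -> W :=
  fun x => 'D_(basis3 R i) f x.

Definition iter_partial (R : realType) (W : normedModType R) (s : seq 'I_3)
    (f : 'rV[R]_3 -> W) : 'rV[R]_3 -> W :=
  foldr (@partial R W) f s.

(* 'D_u f x is a total operator, so existence of each derivative has to be
   required separately. *)
Definition smooth (R : realType) (W : normedModType R)
    (f : 'rV[R]_3 -> W) : Prop :=
  forall s : seq 'I_3,
    continuous (iter_partial s f) /\
    forall (i : 'I_3) (x : 'rV[R]_3),
      derivable (iter_partial s f) x (basis3 R i).

Definition periodic_x3 (R : realType) (W : Type) (f : 'rV[R]_3 -> W) : Prop :=
  forall x : 'rV[R]_3, f (x + basis3 R 2) = f x.

Definition gradient (R : realType) (p : 'rV[R]_3 -> R) (x : 'rV[R]_3) :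
    'rV[R]_3 :=
  \row_(i < 3) partial i p x.

Definition divergence (R : realType) (u : 'rV[R]_3 -> 'rV[R]_3)
    (x : 'rV[R]_3) : R :=
  \sum_(i < 3) partial i u x 0 i.

Definition laplacian (R : realType) (W : normedModType R)
    (f : 'rV[R]_3 -> W) (x : 'rV[R]_3) : W :=
  \sum_(i < 3) partial i (partial i f) x.

Definition convection (R : realType) (u w : 'rV[R]_3 -> 'rV[R]_3)
    (x : 'rV[R]_3) : 'rV[R]_3 :=
  \sum_(j < 3) u x 0 j *: partial j w x.

Definition stationary_NS (R : realType) (v : 'rV[R]_3 -> 'rV[R]_3)
    (P : 'rV[R]_3 -> R) : Prop :=
  forall x : 'rV[R]_3,
    convection v v x + gradient P x - laplacian v x = 0 /\
    divergence v x = 0.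

Definition grad_normsq (R : realType) (u : 'rV[R]_3 -> 'rV[R]_3)
    (x : 'rV[R]_3) : R :=
  \sum_(i < 3) \sum_(j < 3) (partial j u x 0 i) ^+ 2.

(* The canonical structure lookup on [_ \x _] does not find the sigma-finiteness
   of a product of sigma-finite measures, hence the named measures and their
   explicit instances. *)
Definition lebesgue2 (R : realType) :=
  (@lebesgue_measure R \x @lebesgue_measure R)%E.

HB.instance Definition _ (R : realType) := Measure.on (@lebesgue2 R).

Lemma lebesgue2_sigma_finite (R : realType) :
  sigma_finite setT (@lebesgue2 R).
Proof.
by case: (lebesgue_integral_fubini.measure_function_Measure_isSigmaFinite__to__measure_function_isSigmaFinite
  (@lebesgue_measure R) (@lebesgue_measure R)).
Qed.

HB.instance Definition _ (R : realType) :=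
  Measure_isSigmaFinite.Build _ _ _ (@lebesgue2 R) (@lebesgue2_sigma_finite R).

Definition lebesgue3 (R : realType) :=
  (@lebesgue2 R \x @lebesgue_measure R)%E.

HB.instance Definition _ (R : realType) := Measure.on (@lebesgue3 R).

Lemma lebesgue3_sigma_finite (R : realType) :
  sigma_finite setT (@lebesgue3 R).
Proof.
by case: (lebesgue_integral_fubini.measure_function_Measure_isSigmaFinite__to__measure_function_isSigmaFinite
  (@lebesgue2 R) (@lebesgue_measure R)).
Qed.

HB.instance Definition _ (R : realType) :=
  Measure_isSigmaFinite.Build _ _ _ (@lebesgue3 R) (@lebesgue3_sigma_finite R).

Definition dirichlet_integral (R : realType)
    (u : 'rV[R]_3 -> 'rV[R]_3) : \bar R :=
  (\int[@lebesgue3 R]_(y in [set: R * R] `*` `[0%R, 1%R])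
     (grad_normsq u (point3 y.1.1 y.1.2 y.2))%:E)%E.

Definition cyl_radius (R : realType) (x : 'rV[R]_3) : R :=
  Num.sqrt (x 0 0 ^+ 2 + x 0 1 ^+ 2).

Definition e_theta (R : realType) (x : 'rV[R]_3) : 'rV[R]_3 :=
  point3 (- (x 0 1 / cyl_radius x)) (x 0 0 / cyl_radius x) 0.

Definition angular_component (R : realType) (u : 'rV[R]_3 -> 'rV[R]_3)
    (x : 'rV[R]_3) : R :=
  \sum_(i < 3) u x 0 i * e_theta x 0 i.

(* Off the axis r = 0, where e_theta is undefined. *)
Definition axially_symmetric (R : realType) (f : 'rV[R]_3 -> R) : Prop :=
  forall r t t' z : R, 0 < r ->
    f (point3 (r * cos t) (r * sin t) z) =
    f (point3 (r * cos t') (r * sin t') z).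

(* Main.v *)
Require Import Defs.
From HB Require Import structures.
From mathcomp Require Import all_boot all_order all_algebra.
From mathcomp Require Import all_classical all_reals all_analysis.
From mathcomp Require Import measurable_realfun lebesgue_integral_fubini.
From mathcomp Require Import ring lra.

Set Implicit Arguments.
Unset Strict Implicit.
Unset Printing Implicit Defensive.

Import Order.TTheory GRing.Theory Num.Theory.
Import numFieldNormedType.Exports.

Local Open Scope classical_set_scope.
Local Open Scope ring_scope.

(** The proof is a localized energy estimate in which the axial symmetry of
    the angular component supplies the missing decay of the radial one.

    Write x_h = (x_1, x_2), r = |x_h| and w = x_1 v_1 + x_2 v_2 = r v^r.  As
    r v^theta does not depend on theta, the divergence equation gives
    (x_1 d_1 + x_2 d_2) w = - r^2 d_3 v_3.  Averaged over a period in x_3, the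
    right-hand side vanishes, so the mean of w in x_3 is constant along
    horizontal rays; it vanishes on the axis, hence everywhere
    ([mean_flux0]).  Therefore w = d_3 Psi, where
    Psi(x_h, x_3) = \int_0^x_3 w(x_h, s) ds vanishes at x_3 = 0 and at x_3 = 1.

    Test the equation with phi v, for a radial cut-off phi = (1 - r^2/a^2)_+^3.
    As grad phi = psi x_h, the dangerous term is the integral of Q psi w, with
    Q = |v|^2/2 + P the head.  Integration by parts in x_3 turns it into the
    integral of - d_3 Q psi Psi, and the third equation
    d_3 Q = v . d_3 v + Lap v_3 - v . grad v_3 eliminates the pressure; the
    Laplacian is integrated by parts once more.  No bound on the pressure and
    no elliptic regularity enter.  What remains is linear in grad v, with
    coefficients O(1/a) up to the vertical mean of |grad v|, which comes from
    the horizontal derivatives of Psi.  With G the sum of all |d_j v_i|, this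
    gives ([energy_le])
      \int phi |grad v|^2 <= (C \int G + 6 \int G^2) / a,
    where the right-hand integrals are over the box [-a, a]^2 x [0, 1].

    Finite Dirichlet energy makes the second term O(1/a), and the first one
    tends to 0 as well: by Cauchy-Schwarz only the energy outside a fixed box
    matters for large a, since the box has volume 4 a^2
    ([boxX_mean_decay]).  So grad v = 0, v is constant, and a constant vector
    whose angular component is independent of theta is vertical.

    All integrations by parts take place in iterated one-dimensional integrals
    of continuous functions: the fundamental theorem of calculus and
    differentiation under the integral sign replace Fubini's theorem
    ([boxX_pd]).  Tonelli's theorem is used once, to bound these integrals by
    the Dirichlet integral ([box_le_lebesgue3]). *)

(** * One-dimensional integrals of continuous functions *)

Section cont.
Context {R : realType} {X : topologicalType}.
Implicit Types (f g : X -> R).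

Lemma contD f g : continuous f -> continuous g -> continuous (fun x => f x + g x).
Proof. by move=> cf cg x; apply: cvgD; [exact: cf|exact: cg]. Qed.

Lemma contB f g : continuous f -> continuous g -> continuous (fun x => f x - g x).
Proof. by move=> cf cg x; apply: cvgB; [exact: cf|exact: cg]. Qed.

Lemma contN f : continuous f -> continuous (fun x => - f x).
Proof. by move=> cf x; apply: cvgN; exact: cf. Qed.

Lemma contM f g : continuous f -> continuous g -> continuous (fun x => f x * g x).
Proof. by move=> cf cg x; apply: cvgM; [exact: cf|exact: cg]. Qed.

Lemma contX f n : continuous f -> continuous (fun x => f x ^+ n).
Proof.
move=> cf; elim: n => [|n IH]; first by move=> x; exact: cst_continuous.
by under eq_fun do rewrite exprS; exact: contM.
Qed.

Lemma cont_cst (c : R) : continuous (fun _ : X => c).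
Proof. by move=> x; exact: cst_continuous. Qed.

Lemma cont_norm f : continuous f -> continuous (fun x => `|f x|).
Proof. by move=> cf x; apply: cvg_norm; exact: cf. Qed.

End cont.

Section itg.
Context {R : realType}.
Implicit Types (a b c x : R) (f g F : R -> R).
Local Notation mu := (@lebesgue_measure R).

Definition itg a b f : R := \int[mu]_(x in `[a, b]) f x.

Lemma itg_integrable a b f : continuous f ->
  mu.-integrable `[a, b] (EFin \o f).
Proof.
move=> cf; apply: continuous_compact_integrable; first exact: segment_compact.
exact: continuous_subspaceT.
Qed.

Lemma eq_itg a b f g : (forall x, a <= x <= b -> f x = g x) ->
  itg a b f = itg a b g.
Proof.
by move=> fg; apply: eq_Rintegral => x; rewrite inE/= in_itv/=; exact: fg.
Qed.

Lemma itgD a b f g : continuous f -> continuous g ->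
  itg a b (fun x => f x + g x) = itg a b f + itg a b g.
Proof. by move=> cf cg; apply: RintegralD => //; exact: itg_integrable. Qed.

Lemma itgZ a b c f : continuous f ->
  itg a b (fun x => c * f x) = c * itg a b f.
Proof. by move=> cf; apply: RintegralZl => //; exact: itg_integrable. Qed.

Lemma le_itg a b f g : continuous f -> continuous g ->
  (forall x, a <= x <= b -> f x <= g x) -> itg a b f <= itg a b g.
Proof.
move=> cf cg fg; apply: le_Rintegral ; [by []|exact: itg_integrable|exact: itg_integrable|].
by move=> x /=; rewrite in_itv/=; exact: fg.
Qed.

Lemma itg_ge0 a b f : (forall x, a <= x <= b -> 0 <= f x) -> 0 <= itg a b f.
Proof.
by move=> f0; apply: Rintegral_ge0 => x /=; rewrite in_itv/=; exact: f0.
Qed.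

Lemma normr_itg a b f : continuous f ->
  `|itg a b f| <= itg a b (fun x => `|f x|).
Proof. by move=> cf; apply: le_normr_Rintegral => //; exact: itg_integrable. Qed.

Lemma itg_subset a b c d f : continuous f -> (forall x, 0 <= f x) ->
  c <= a -> b <= d -> itg a b f <= itg c d f.
Proof.
move=> cf f0 ca bd; rewrite /itg /Rintegral.
have I x y : (\int[mu]_(t in `[x, y]) (f t)%:E \is a fin_num)%E.
  by apply: integrable_fin_num; [by []|exact: itg_integrable].
apply: fine_le; [exact: I|exact: I|].
apply: ge0_subset_integral => //.
- exact: (measurable_int mu (itg_integrable _ _ cf)).
- by move=> x _; rewrite lee_fin.
- by apply: subset_itvScc; rewrite bnd_simp.
Qed.

Lemma itg_FTC a b f F : a < b -> continuous f ->
  (forall x, a <= x <= b -> is_derive x (1 : R) F (f x)) -> itg a b f = F b - F a.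
Proof.
move=> ab cf dF.
have dF' x : a <= x <= b -> derivable F x 1 by move=> /dF [].
have cF x : a <= x <= b -> F t @[t --> x] --> F x.
  by move=> xab; apply: differentiable_continuous; exact/derivable1_diffP/dF'.
rewrite /itg /Rintegral (@continuous_FTC2 _ f F)//.
- exact: continuous_subspaceT.
- split.
  + by move=> x; rewrite in_itv/= => /andP[ax xb]; apply: dF'; rewrite !ltW.
  + by apply: cvg_at_right_filter; apply: cF; rewrite lexx ltW.
  + by apply: cvg_at_left_filter; apply: cF; rewrite lexx ltW.
- move=> x; rewrite in_itv/= => /andP[ax xb].
  by rewrite derive1E; case: (dF x) => //; rewrite !ltW.
Qed.

Lemma itg_primitive a f : continuous f ->
  exists F, forall x, a < x -> is_derive x (1 : R) F (f x).
Proof.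
move=> cf; exists (fun x => itg a x f) => x ax.
have [||d1 d2] := @continuous_FTC1_closed _ f a x (x + 1) _ _ ax (cf x).
- by rewrite ltrDl.
- exact: itg_integrable.
- by apply: DeriveDef => //; rewrite -derive1E.
Qed.

Lemma itg_cst a b c : a < b -> itg a b (fun=> c) = c * (b - a).
Proof.
move=> ab.
have d x : is_derive x (1 : R) (fun t => c * t) c.
  by apply: is_derive_eq; rewrite scaler1.
rewrite (@itg_FTC a b (fun=> c) (fun t => c * t) ab _ (fun x _ => d x)); first by ring.
by move=> x; exact: cst_continuous.
Qed.

Lemma normr_itg_le a b c f : a < b -> continuous f ->
  (forall x, a <= x <= b -> `|f x| <= c) -> `|itg a b f| <= c * (b - a).
Proof.
move=> ab cf fc; apply: le_trans (normr_itg _ _ cf) _.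
rewrite -itg_cst//; apply: le_itg => //; last by move=> x; exact: cst_continuous.
by move=> x; apply: continuous_comp; [exact: cf|exact: norm_continuous].
Qed.

Lemma itgB a b f g : continuous f -> continuous g ->
  itg a b (fun x => f x - g x) = itg a b f - itg a b g.
Proof. by move=> cf cg; apply: RintegralB => //; exact: itg_integrable. Qed.

End itg.

Section param.
Context {R : realType}.

Lemma continuous_curry1 (X Y Z : topologicalType) (f : X -> Y -> Z) :
  continuous (fun p : X * Y => f p.1 p.2) -> forall x, continuous (f x).
Proof.
move=> cf x y; apply: (@cvg_comp _ _ _ (fun t => (x, t)) (fun p => f p.1 p.2) (nbhs y)
  (nbhs (x, y))); last exact: (cf (x, y)).
by apply: cvg_pair; [exact: cvg_cst|exact: cvg_id].
Qed.

(** Uniformity over the compact interval, in the parameter alone: it is what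
    allows limits to pass under the integral sign below. *)
Lemma near_uniform (X : topologicalType) (f : X -> R -> R) (a b : R) (x0 : X) e :
  continuous (fun p : X * R => f p.1 p.2) -> 0 < e ->
  \forall x \near x0, forall y, a <= y <= b -> `|f x y - f x0 y| < e.
Proof.
move=> cf e0.
have /compact_near_coveringP := @segment_compact R a b.
move=> /(_ _ (nbhs x0) (fun x y => `|f x y - f x0 y| < e) _) H.
have: (\forall x' \near x0, `[a, b]%classic `<=` (fun y => `|f x' y - f x0 y| < e)).
  apply: H => y _.
  have /cvgrPdist_lt /(_ (e/2)) := cf (x0, y).
  rewrite divr_gt0// => /(_ isT)[[A B]]/= [Ax By] AB.
  exists (B, A) => //= -[y' x'] /= [By' Ax'].
  have h1 := AB (x', y') (conj Ax' By').
  have h2 := AB (x0, y') (conj (nbhs_singleton Ax) By').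
  rewrite /= in h1 h2.
  rewrite (_ : f x' y' - f x0 y' = (f x0 y - f x0 y') - (f x0 y - f x' y')); last by ring.
  by rewrite (splitr e) (le_lt_trans (ler_normB _ _))// ltrD.
apply: filterS => x' H' y yab; apply: H' => /=.
by rewrite in_itv.
Qed.

Lemma continuous_itg (X : topologicalType) (f : X -> R -> R) (a b : R) :
  a < b -> continuous (fun p : X * R => f p.1 p.2) ->
  continuous (fun x => itg a b (f x)).
Proof.
move=> ab cf x0; apply/cvgrPdist_le => e e0.
have ba0 : 0 < b - a by rewrite subr_gt0.
have := near_uniform a b x0 cf (divr_gt0 e0 ba0).
apply: filterS => x H.
rewrite -itgB; [|exact: continuous_curry1 cf _ ..].
rewrite -[e](@divfK _ (b - a)) ?gt_eqF//; apply: normr_itg_le => //.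
  by apply: contB; exact: continuous_curry1 cf _.
by move=> y yab; rewrite distrC ltW// H.
Qed.

Lemma is_derive_lim (f : R -> R) (x l : R) :
  (forall e, 0 < e -> \forall h \near 0^', `|h^-1 * (f (h + x) - f x) - l| <= e) ->
  is_derive x (1 : R) f l.
Proof.
move=> H.
have C : h^-1 *: (f (h *: (1:R) + x) - f x) @[h --> 0^'] --> l.
  apply/cvgrPdist_le => e /H; apply: filterS => h.
  by rewrite distrC scaler1.
apply: DeriveDef; first by apply/cvg_ex; exists l.
exact/cvg_lim.
Qed.

(** The mean value theorem for an increment of either sign. *)
Lemma MVT_line (f f' : R -> R) (x h : R) :
  (forall x : R, is_derive x (1 : R) f (f' x)) ->
  exists2 c, `|c - x| <= `|h| & f (h + x) - f x = f' c * h.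
Proof.
move=> df.
have cf : continuous f.
  by move=> t; apply: differentiable_continuous; apply/derivable1_diffP; case: (df t).
have [h0|h0|->] := ltgtP h 0.
- have hx : h + x < x by lra.
  have [c cx e] := @MVT _ f f' _ _ hx (fun t _ => df t) (continuous_subspaceT cf).
  exists c; last by rewrite -opprB e; ring.
    by move: cx; rewrite in_itv/= => /andP[? ?]; rewrite ltr0_norm ?ltr0_norm; lra.
- have hx : x < h + x by lra.
  have [c cx e] := @MVT _ f f' _ _ hx (fun t _ => df t) (continuous_subspaceT cf).
  exists c; last by rewrite e; ring.
    by move: cx; rewrite in_itv/= => /andP[? ?]; rewrite gtr0_norm ?gtr0_norm; lra.
- by exists x; [rewrite subrr|rewrite add0r subrr mulr0].
Qed.

(** The difference quotients converge to the partial derivative uniformly in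
    the integration variable, by the mean value theorem and [near_uniform]. *)
Lemma is_derive_itg (f f' : R -> R -> R) (a b : R) : a < b ->
  (forall x y : R, is_derive x (1 : R) (f^~ y) (f' x y)) ->
  (forall x, continuous (f x)) ->
  continuous (fun p : R * R => f' p.1 p.2) ->
  forall x : R, is_derive x (1 : R) (fun x => itg a b (f x)) (itg a b (f' x)).
Proof.
move=> ab df cf cf' x; apply: is_derive_lim => e e0.
have ba0 : 0 < b - a by rewrite subr_gt0.
have /nbhs_ballP[d /= d0 dP] := near_uniform a b x cf' (divr_gt0 e0 ba0).
near=> h.
have h0 : h != 0 by near: h; exact: nbhs_dnbhs_neq.
have hd : `|h| < d by near: h; exact: dnbhs0_lt.
have cB u v : continuous (fun y => f u y - f v y).
  by apply: contB; exact: cf.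
have cZ u v : continuous (fun y => h^-1 * (f u y - f v y)).
  by apply: contM; [exact: cont_cst|exact: cB].
have cx : continuous (f' x) by move=> y; exact: (continuous_curry1 cf').
rewrite -itgB// -itgZ// -itgB//.
rewrite -[e](@divfK _ (b - a)) ?gt_eqF//; apply: normr_itg_le => //.
  by apply: contB; [exact: cZ|exact: cx].
move=> y yab; have [c cd ->] := MVT_line x h (df^~ y).
rewrite mulrC mulfK// ltW//; apply: dP => //.
by rewrite /ball/= distrC (le_lt_trans cd).
Unshelve. all: by end_near. Qed.

End param.

(** * Primitives written over a fixed interval *)

Section prim.
Context {R : realType}.
Implicit Types (f g F : R -> R) (x y z t : R).

Lemma is_derive_continuous f (f' : R -> R) :
  (forall x, is_derive x (1 : R) f (f' x)) -> continuous f.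
Proof.
move=> df x; apply: differentiable_continuous; apply/derivable1_diffP.
by case: (df x).
Qed.

Lemma is_derive_le f (f' : R -> R) a b : a <= b ->
  (forall x, a <= x <= b -> is_derive x (1 : R) f (f' x)) ->
  (forall x, a <= x <= b -> 0 <= f' x) -> f a <= f b.
Proof.
move=> ab df f0.
have H : {within `[a, b], continuous f}.
  apply: derivable_within_continuous => x; rewrite in_itv/= => xab.
  by case: (df x xab).
apply: (@ger0_derive1_ndecr _ f a b) => // x; rewrite in_itv/= => /andP[ax xb].
  by case: (df x) => //; rewrite !ltW.
by rewrite derive1E; case: (df x) => [|_ ->]; rewrite ?f0// !ltW.
Qed.

(** This is \int_0^z g, rescaled to the fixed interval [0, 1] so that
    dependence on parameters follows from the theorems on integrals with fixed
    bounds. *)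
Definition prim g z : R := z * itg 0 1 (fun t => g (t * z)).

Lemma cont_scale (z : R) : continuous (fun t : R => t * z).
Proof. by move=> t; exact: mulrr_continuous. Qed.

Lemma is_derive_scaler (z t : R) : is_derive t (1 : R) (fun t => t * z) z.
Proof.
have -> : (fun t => t * z) = (fun t => z * t) by apply/funext => ?; rewrite mulrC.
by apply: is_derive_eq; rewrite scaler1.
Qed.

Lemma is_derive_dilate F f z t : is_derive (t * z) (1 : R) F (f (t * z)) ->
  is_derive t (1 : R) (fun t => F (t * z)) (z * f (t * z)).
Proof.
move=> dF; rewrite mulrC; apply: is_derive1_comp => //; exact: is_derive_scaler.
Qed.

(** The integrand g(tz) + tz g'(tz) produced by differentiating under the
    integral is the t-derivative of t g(tz). *)
Lemma is_derive_prim g (g' : R -> R) : continuous g' ->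
  (forall x, is_derive x (1 : R) g (g' x)) ->
  forall z, is_derive z (1 : R) (prim g) (g z).
Proof.
move=> cg' dg z.
have cg := is_derive_continuous dg.
have c2 (u : R -> R) (cu : continuous u) :
    continuous (fun p : R * R => u (p.2 * p.1)).
  move=> p; apply: (@cvg_comp _ _ _ (fun p => p.2 * p.1) u); last exact: cu.
  by apply: cvgM; [exact: cvg_snd|exact: cvg_fst].
have c1 (u : R -> R) z' (cu : continuous u) : continuous (fun t => u (t * z')).
  by move=> t; apply: (@cvg_comp _ _ _ (fun t => t * z') u); [exact: cont_scale|exact: cu].
have cp1 : continuous (fun p : R * R => p.1) by move=> p; exact: cvg_fst.
have cp2 : continuous (fun p : R * R => p.2) by move=> p; exact: cvg_snd.
(* The outer factor z is moved inside, to differentiate a single integral. *)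
have -> : prim g = (fun z => itg 0 1 (fun t => z * g (t * z))).
  by apply/funext => y; rewrite /prim itgZ//; exact: c1.
pose f' z t := g (t * z) + z * (t * g' (t * z)).
have df x y : is_derive x (1 : R) (fun z => z * g (y * z)) (f' x y).
  have h : is_derive x (1 : R) (fun z => g (y * z)) (y * g' (y * x)).
    have := @is_derive_dilate g g' y x; rewrite mulrC => H.
    by under eq_fun do rewrite mulrC; exact: H.
  apply: is_derive_eq; rewrite /f' [_ *: (1 : R)]mulr1 /GRing.scale/=; ring.
have cf' : continuous (fun p : R * R => f' p.1 p.2).
  rewrite /f'; apply: contD; first exact: c2.
  by apply: contM => //; apply: contM => //; exact: c2.
have -> : g z = itg 0 1 (f' z).
  have dt x : 0 <= x <= 1 -> is_derive x (1 : R) (fun t => t * g (t * z)) (f' z x).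
    move=> _; have h := is_derive_dilate (dg (x * z)).
    apply: is_derive_eq; rewrite /f' [_ *: (1 : R)]mulr1 /GRing.scale/=; ring.
  rewrite (itg_FTC ltr01 _ dt); first by rewrite !mul1r mul0r subr0.
  by move=> t; exact: (continuous_curry1 cf').
apply: is_derive_itg => //.
move=> x; apply: contM; [exact: cont_cst|exact: c1].
Qed.

(** The bound h is only continuous, so that the change of variables goes
    through a primitive of h on a neighbourhood of [0, 1]. *)
Lemma prim_le g h z : continuous g -> continuous h -> (forall t, `|g t| <= h t) ->
  0 <= z <= 1 -> `|prim g z| <= itg 0 1 h.
Proof.
move=> cg ch gh /andP[z0 z1]; have [H dH] := itg_primitive (-1) ch.
have h0 t : 0 <= h t by apply: le_trans (gh t).
have c1 (u : R -> R) (cu : continuous u) : continuous (fun t => u (t * z)).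
  by move=> t; apply: (@cvg_comp _ _ _ (fun t => t * z) u); [exact: cont_scale|exact: cu].
rewrite /prim normrM ger0_norm//.
apply: (@le_trans _ _ (z * itg 0 1 (fun t => h (t * z)))).
  apply: ler_wpM2l => //; apply: le_trans (normr_itg _ _ _) _; first exact: c1.
  by apply: le_itg => //; [apply: cont_norm; exact: c1|exact: c1].
rewrite -itgZ; last exact: c1.
have d1 x : 0 <= x <= 1 ->
    is_derive x (1 : R) (fun t => H (t * z)) (z * h (x * z)).
  move=> /andP[x0 x1]; apply: is_derive_dilate; apply: dH.
  by have := mulr_ge0 x0 z0; lra.
have d2 x : 0 <= x <= 1 -> is_derive x (1 : R) H (h x).
  by move=> /andP[x0 x1]; apply: dH; lra.
rewrite (itg_FTC ltr01 _ d1); last by apply: contM; [exact: cont_cst|exact: c1].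
rewrite (itg_FTC ltr01 _ d2)//.
rewrite mul1r mul0r lerD2r; apply: (@is_derive_le H h z 1 z1) => x /andP[zx x1]; last exact: h0.
by apply: dH; lra.
Qed.

End prim.

(** * Integrals over boxes *)

Section box.
Context {R : realType}.
Implicit Types (f g F : R -> R -> R -> R) (a b x y z : R).

Definition cont3 f := continuous (fun p : R * R * R => f p.1.1 p.1.2 p.2).

Definition box a f : R :=
  itg (- a) a (fun x => itg (- a) a (fun y => itg 0 1 (f x y))).

Lemma cont_comp (X Y Z : topologicalType) (u : X -> Y) (g : Y -> Z) :
  continuous g -> continuous u -> continuous (fun t => g (u t)).
Proof. by move=> cg cu t; apply: (@cvg_comp _ _ _ u g); [exact: cu|exact: cg]. Qed.

Lemma cont_pair (X Y Z : topologicalType) (u : X -> Y) (v : X -> Z) :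
  continuous u -> continuous v -> continuous (fun t => (u t, v t)).
Proof. by move=> cu cv t; apply: cvg_pair; [exact: cu|exact: cv]. Qed.

Lemma cont3_comp (X : topologicalType) f (u v w : X -> R) : cont3 f ->
  continuous u -> continuous v -> continuous w ->
  continuous (fun t => f (u t) (v t) (w t)).
Proof.
move=> cf cu cv cw.
apply: (@cont_comp _ _ _ (fun t => (u t, v t, w t)) (fun p => f p.1.1 p.1.2 p.2) cf).
by apply: cont_pair => //; exact: cont_pair.
Qed.

Lemma cont_id : continuous (fun t : R => t).
Proof. by move=> t; exact: cvg_id. Qed.

Lemma cont_fst (X Y : topologicalType) : continuous (fun p : X * Y => p.1).
Proof. by move=> p; exact: cvg_fst. Qed.

Lemma cont_snd (X Y : topologicalType) : continuous (fun p : X * Y => p.2).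
Proof. by move=> p; exact: cvg_snd. Qed.

Lemma cont_fst_comp (X Y Z : topologicalType) (u : X -> Z) :
  continuous u -> continuous (fun p : X * Y => u p.1).
Proof. by move=> cu p; apply: (@cvg_comp _ _ _ fst u); [exact: cvg_fst|exact: cu]. Qed.

Lemma cont3_z f x y : cont3 f -> continuous (f x y).
Proof.
by move=> cf; apply: (cont3_comp cf); [exact: cont_cst|exact: cont_cst|exact: cont_id].
Qed.

Lemma cont3_xz f y : cont3 f -> continuous (fun p : R * R => f p.1 y p.2).
Proof.
by move=> cf; apply: (cont3_comp cf); [exact: cont_fst|exact: cont_cst|exact: cont_snd].
Qed.

Lemma cont3_yz f x : cont3 f -> continuous (fun p : R * R => f x p.1 p.2).
Proof.
by move=> cf; apply: (cont3_comp cf); [exact: cont_cst|exact: cont_fst|exact: cont_snd].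
Qed.

Lemma cont_itg1 f : cont3 f -> continuous (fun p : R * R => itg 0 1 (f p.1 p.2)).
Proof. by move=> cf; exact: (@continuous_itg _ (R * R)%type (fun p => f p.1 p.2) 0 1 ltr01). Qed.

Lemma cont_itg1y f x : cont3 f -> continuous (fun y => itg 0 1 (f x y)).
Proof.
by move=> /cont_itg1 cf y; exact: (@continuous_curry1 _ _ _ (fun x y => itg 0 1 (f x y)) cf).
Qed.

Lemma cont_itg1x f y : cont3 f -> continuous (fun x => itg 0 1 (f x y)).
Proof.
move=> cf; apply: (@continuous_itg _ R (fun x => f x y) 0 1 ltr01); exact: cont3_xz.
Qed.

Lemma cont_itg2 a f : 0 < a -> cont3 f ->
  continuous (fun x => itg (- a) a (fun y => itg 0 1 (f x y))).
Proof.
move=> a0 cf; apply: (@continuous_itg _ R (fun x y => itg 0 1 (f x y))); first lra.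
exact: cont_itg1.
Qed.

Lemma boxD a f g : 0 < a -> cont3 f -> cont3 g ->
  box a (fun x y z => f x y z + g x y z) = box a f + box a g.
Proof.
move=> a0 cf cg; rewrite /box -itgD; [|exact: cont_itg2..].
apply: eq_itg => x _; rewrite -itgD; [|exact: cont_itg1y..].
by apply: eq_itg => y _; rewrite -itgD//; exact: cont3_z.
Qed.

Lemma boxZ a c f : 0 < a -> cont3 f ->
  box a (fun x y z => c * f x y z) = c * box a f.
Proof.
move=> a0 cf; rewrite /box -itgZ; last exact: cont_itg2.
apply: eq_itg => x _; rewrite -itgZ; last exact: cont_itg1y.
by apply: eq_itg => y _; rewrite -itgZ//; exact: cont3_z.
Qed.

Lemma le_box a f g : 0 < a -> cont3 f -> cont3 g ->
  (forall x y z, -a <= x <= a -> -a <= y <= a -> 0 <= z <= 1 ->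
  f x y z <= g x y z) -> box a f <= box a g.
Proof.
move=> a0 cf cg fg; apply: le_itg; [exact: cont_itg2..|move=> x xa].
apply: le_itg; [exact: cont_itg1y..|move=> y ya].
by apply: le_itg; [exact: cont3_z..|move=> z za]; exact: fg.
Qed.

Lemma box_ge0 a f : (forall x y z, 0 <= f x y z) -> 0 <= box a f.
Proof. by move=> f0; do 3! apply: itg_ge0 => ? _. Qed.

Lemma box_subset a b f : 0 < a <= b -> cont3 f -> (forall x y z, 0 <= f x y z) ->
  box a f <= box b f.
Proof.
move=> /andP[a0 ab] cf f0; have b0 := lt_le_trans a0 ab.
apply: (@le_trans _ _ (itg (-a) a (fun x => itg (- b) b (fun y => itg 0 1 (f x y))))).
  apply: le_itg; [exact: cont_itg2..|move=> x _].
  apply: itg_subset; [exact: cont_itg1y|..|lra|lra].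
  by move=> y; apply: itg_ge0.
apply: itg_subset; [exact: cont_itg2|..|lra|lra].
by move=> x; do 2! apply: itg_ge0 => ? _.
Qed.

Lemma box_cst a c : 0 < a -> box a (fun _ _ _ => c) = c * (4 * a ^+ 2).
Proof.
move=> a0; have aa : - a < a by lra.
rewrite /box; under eq_itg => x _.
  under eq_itg => y _ do rewrite itg_cst ?ltr01//.
  rewrite itg_cst//; over.
by rewrite /= itg_cst//; ring.
Qed.

(** Differentiating the inner integrals under the integral sign makes f the
    derivative of a function of x alone; no exchange of integrals is needed. *)
Lemma box_dx a F f : 0 < a -> cont3 F -> cont3 f ->
  (forall x y z, is_derive x (1 : R) (fun x => F x y z) (f x y z)) ->
  (forall y z, F a y z = F (- a) y z) -> box a f = 0.
Proof.
move=> a0 cF cf dF bF; have aa : - a < a by lra.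
have d1 y : forall x, is_derive x (1 : R) (fun x => itg 0 1 (F x y)) (itg 0 1 (f x y)).
  apply: (@is_derive_itg _ (fun x => F x y) (fun x => f x y) 0 1 ltr01) => //.
    by move=> x; exact: cont3_z.
  exact: cont3_xz.
have d2 : forall x, is_derive x (1 : R)
    (fun x => itg (-a) a (fun y => itg 0 1 (F x y))) (itg (-a) a (fun y => itg 0 1 (f x y))).
  apply: (@is_derive_itg _ (fun x y => itg 0 1 (F x y)) (fun x y => itg 0 1 (f x y)) _ _ aa).
  - by move=> x; exact: cont_itg1y.
  - exact: cont_itg1.
rewrite /box (itg_FTC aa _ (fun x _ => d2 x)); last exact: cont_itg2.
by apply/eqP; rewrite subr_eq0; apply/eqP; apply: eq_itg => y _; apply: eq_itg => z _.
Qed.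

Lemma box_dy a F f : 0 < a -> cont3 F -> cont3 f ->
  (forall x y z, is_derive y (1 : R) (fun y => F x y z) (f x y z)) ->
  (forall x z, F x a z = F x (- a) z) -> box a f = 0.
Proof.
move=> a0 cF cf dF bF; have aa : - a < a by lra.
have d1 x : forall y, is_derive y (1 : R) (fun y => itg 0 1 (F x y)) (itg 0 1 (f x y)).
  apply: (@is_derive_itg _ (F x) (f x) 0 1 ltr01) => //.
    by move=> y; exact: cont3_z.
  exact: cont3_yz.
rewrite /box -[RHS](mul0r (a - - a)) -itg_cst//; apply: eq_itg => x _.
rewrite (itg_FTC aa _ (fun y _ => d1 x y)); last exact: cont_itg1y.
by apply/eqP; rewrite subr_eq0; apply/eqP; apply: eq_itg => z _.
Qed.

Lemma box_dz a F f : 0 < a -> cont3 f ->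
  (forall x y z, is_derive z (1 : R) (fun z => F x y z) (f x y z)) ->
  (forall x y, F x y 1 = F x y 0) -> box a f = 0.
Proof.
move=> a0 cf dF bF; have aa : - a < a by lra.
rewrite /box -[RHS](mul0r (a - - a)) -itg_cst//; apply: eq_itg => x _.
rewrite -[RHS](mul0r (a - - a)) -itg_cst//; apply: eq_itg => y _.
rewrite (itg_FTC ltr01 _ (fun z _ => dF x y z)); last exact: cont3_z.
by rewrite bF subrr.
Qed.

(** A primitive of a nonnegative function with equal end values is constant. *)
Lemma itg_eq0 a b (f : R -> R) : a < b -> continuous f -> (forall x, 0 <= f x) ->
  itg a b f = 0 -> forall x, a < x < b -> f x = 0.
Proof.
move=> ab cf f0 f1 x /andP[ax xb].
have [F dF] := itg_primitive (a - 1) cf.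
have dF' t : a <= t <= b -> is_derive t (1 : R) F (f t) by move=> ?; apply: dF; lra.
have Fab : F b - F a = 0 by rewrite -f1 (itg_FTC ab cf dF').
have Fc t : a <= t <= b -> F t = F a.
  move=> /andP[at_ tb].
  have d1 s : t <= s <= b -> is_derive s (1 : R) F (f s) by move=> ?; apply: dF'; lra.
  have d2 s : a <= s <= t -> is_derive s (1 : R) F (f s) by move=> ?; apply: dF'; lra.
  have e1 := is_derive_le tb d1 (fun s _ => f0 s).
  have e2 := is_derive_le at_ d2 (fun s _ => f0 s).
  by apply/le_anti; rewrite e2 andbT (le_trans e1)// -subr_le0 Fab.
have dx : is_derive x (1 : R) F (f x) by apply: dF'; rewrite !ltW.
have d0 : is_derive x (1 : R) F 0.
  apply: is_derive_lim => e e0; near=> h.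
  have : `|h| < Num.min (x - a) (b - x).
    by near: h; apply: dnbhs0_lt; rewrite lt_min; apply/andP; split; lra.
  rewrite lt_min => /andP[h1 h2].
  have xab : a <= x <= b by rewrite !ltW.
  have hab : a <= h + x <= b.
    have := ler_norm h; have := ler_norm (- h); rewrite normrN => ? ?.
    by apply/andP; split; lra.
  by rewrite !Fc// subrr mulr0 subrr normr0 ltW.
by case: dx => _ <-; case: d0.
Unshelve. all: by end_near. Qed.

Lemma box_eq0 a f : 0 < a -> cont3 f -> (forall x y z, 0 <= f x y z) ->
  box a f = 0 ->
  forall x y z, -a < x < a -> -a < y < a -> 0 < z < 1 -> f x y z = 0.
Proof.
move=> a0 cf f0 b0 x y z xa ya za; have aa : - a < a by lra.
have g0 u v : 0 <= itg 0 1 (f u v) by apply: itg_ge0.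
apply: (itg_eq0 ltr01) za => //; first exact: cont3_z.
apply: (@itg_eq0 (-a) a (fun y => itg 0 1 (f x y))) ya => //; first exact: cont_itg1y.
apply: (@itg_eq0 (-a) a (fun x => itg (-a) a (fun y => itg 0 1 (f x y)))) xa => //.
  exact: cont_itg2.
by move=> u; apply: itg_ge0 => v _.
Qed.

End box.

(** * Comparison with the Lebesgue integral *)

Section measurability.
Context {R : realType}.

(** A function measurable in the first variable and continuous in the second
    is the pointwise limit of functions that are step functions of the second
    variable.  Iterated, this makes continuous functions of several variables
    measurable for the product sigma-algebra. *)
Lemma measurable_fun_caratheodory d (T : measurableType d)
    (f : T * measurableTypeR R -> R) :
  (forall x : R, measurable_fun setT (fun t => f (t, x))) ->
  (forall t, continuous (fun x : R => f (t, x))) ->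
  measurable_fun setT f.
Proof.
move=> mf cf.
pose q n (x : R) : R := (Num.floor (n.+1%:R * x))%:~R / n.+1%:R.
apply: (@measurable_fun_cvg _ _ _ _ (fun n p => f (p.1, q n p.2))); last first.
  move=> [t x] _ /=.
  apply: (@cvg_comp _ _ _ (fun n => q n x) (fun y => f (t, y)) \oo (nbhs x)); last exact: cf.
  apply/cvgrPdist_le => e e0; near=> n.
  have n0 : 0 < n.+1%:R :> R by rewrite ltr0n.
  have /andP[h1 h2] := floor_itv (n.+1%:R * x).
  rewrite intrD in h2.
  have h3 : n.+1%:R^-1 <= e
    by near: n; have := near_infty_natSinv_lt (PosNum e0); apply: filterS => m /ltW.
  apply: le_trans h3.
  rewrite -[x in `|x - _|](mulKf (lt0r_neq0 n0)) [_^-1 * _]mulrC /q -mulrBl normrM.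
  rewrite [X in _ * X]gtr0_norm ?invr_gt0// ler_piMl ?invr_ge0 ?ltW//.
  by rewrite ger0_norm; lra.
move=> n _ Y mY; rewrite setTI.
have n0 : 0 < n.+1%:R :> R by rewrite ltr0n.
(* The cells where floor ((n + 1) x) = k partition the second axis. *)
rewrite [X in measurable X](_ : _ = \bigcup_(k : int)
   ((fun t => f (t, k%:~R / n.+1%:R)) @^-1` Y `*`
    `[k%:~R / n.+1%:R, (k + 1)%:~R / n.+1%:R[)); last first.
  apply/seteqP; split => [[t x] /= Yq|[t x] [k _] [/= Yk]].
    exists (Num.floor (n.+1%:R * x)) => //; split => //=.
    have /andP[h1 h2] := floor_itv (n.+1%:R * x).
    by rewrite in_itv/= ler_pdivrMr// ltr_pdivlMr// [x * _]mulrC h1.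
  rewrite in_itv/= ler_pdivrMr// ltr_pdivlMr// [x * _]mulrC => kx.
  suff -> : q n x = k%:~R / n.+1%:R by [].
  by rewrite /q (floor_def kx).
apply: countable_bigcupT_measurable => [|k]; first exact: countableP.
apply: measurableX; last exact: measurable_itv.
by rewrite -[X in measurable X]setTI; exact: mf.
Unshelve. all: by end_near. Qed.

Lemma measurable_cont3 (f : R -> R -> R -> R) : cont3 f ->
  measurable_fun setT (fun p : measurableTypeR R * measurableTypeR R * measurableTypeR R =>
    f p.1.1 p.1.2 p.2).
Proof.
move=> cf; apply: measurable_fun_caratheodory => [z|[x y]]; last first.
  by move=> z /=; exact: cont3_z.
apply: measurable_fun_caratheodory => [y|x].
  apply: continuous_measurable_fun; apply: (cont3_comp cf); [exact: cont_id|exact: cont_cst..].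
by apply: (cont3_comp cf); [exact: cont_cst|exact: cont_id|exact: cont_cst].
Qed.

Lemma box_le_lebesgue3 a (f : R -> R -> R -> R) : 0 < a -> cont3 f ->
  (forall x y z, 0 <= f x y z) ->
  ((box a f)%:E <= \int[@lebesgue3 R]_(y in [set: R * R] `*` `[0%R, 1%R])
     (f y.1.1 y.1.2 y.2)%:E)%E.
Proof.
move=> a0 cf f0.
pose I : set (measurableTypeR R) := `[- a, a]%classic.
pose J : set (measurableTypeR R) := `[0, 1]%classic.
pose B := (I `*` I) `*` J.
have mI : measurable I by exact: measurable_itv.
have mJ : measurable J by exact: measurable_itv.
have mII : measurable (I `*` I) by exact: measurableX.
have mB : measurable B by exact: measurableX.
have mf := measurable_cont3 cf.
apply: (@le_trans _ _ (\int[@lebesgue3 R]_(y in B) (f y.1.1 y.1.2 y.2)%:E)%E); last first.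
  apply: ge0_subset_integral => //.
  - by apply: measurableX => //; exact: measurableT.
  - by apply/measurable_EFinP; exact: measurable_funTS.
  - by move=> p _; rewrite lee_fin.
  - by move=> p [] _ ?; split.
rewrite integral_mkcond.
rewrite (@fubini_tonelli1 _ _ _ _ _ (@lebesgue2 R) (@lebesgue_measure R)).
- have E1 (u : R -> R) b c : continuous u ->
      (\int[@lebesgue_measure R]_z (((fun t => (u t)%:E) \_ `[b, c]) z) = (itg b c u)%:E)%E.
    move=> cu; rewrite -integral_mkcond /itg /Rintegral fineK//.
    by apply: integrable_fin_num; [by []|exact: itg_integrable].
  pose g (p : measurableTypeR R * measurableTypeR R) : \bar R :=
    (itg 0 1 (f p.1 p.2))%:E.
  have mg : measurable_fun setT g.
    apply/measurable_EFinP; apply: measurable_fun_caratheodory => [y|x].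
      by apply: continuous_measurable_fun; exact: cont_itg1x.
    by move=> y; exact: cont_itg1y.
  have -> : fubini_F (@lebesgue_measure R)
      ((fun p : measurableTypeR R * measurableTypeR R * measurableTypeR R =>
         (f p.1.1 p.1.2 p.2)%:E) \_ B) = g \_ (I `*` I).
    apply/funext => -[x y]; rewrite /fubini_F patchE; case: ifPn => xyI.
      rewrite /g/= -E1; last exact: cont3_z.
      apply: eq_integral => z _; rewrite !patchE; rewrite inE in xyI.
      congr (if _ then _ else _); apply/idP/idP; rewrite !inE /B/=.
        by case.
      by move=> zJ; split.
    apply: integral0_eq => z _; rewrite patchE ifF//.
    by apply/negbTE; apply: contra xyI; rewrite !inE => -[].
  rewrite (@fubini_tonelli1 _ _ _ _ _ (@lebesgue_measure R) (@lebesgue_measure R)).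
  + rewrite /box -E1; last exact: cont_itg2.
    rewrite le_eqVlt; apply/orP; left; apply/eqP.
    apply: eq_integral => x _; rewrite /fubini_F patchE; case: ifPn => xI.
      rewrite -E1; last exact: cont_itg1y.
      apply: eq_integral => y _; rewrite !patchE; rewrite inE in xI.
      congr (if _ then _ else _); apply/idP/idP; rewrite !inE/=.
        by move=> yI; split.
      by case.
    apply/esym; apply: integral0_eq => y _; rewrite patchE ifF//.
    by apply/negbTE; apply: contra xI; rewrite !inE => -[].
  + have h : measurable_fun (I `*` I) g by exact: measurable_funTS.
    exact: ((measurable_restrictT g mII).1 h).
  + move=> p; rewrite patchE; case: ifP => // _; rewrite lee_fin.
    by apply: itg_ge0.
- have h : measurable_fun B (fun p => (f p.1.1 p.1.2 p.2)%:E).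
    by apply/measurable_EFinP; exact: measurable_funTS.
  exact: ((measurable_restrictT _ mB).1 h).
- by move=> p; rewrite patchE; case: ifP => // _; rewrite lee_fin.
Qed.
End measurability.

(** * Partial derivatives and the divergence theorem on a periodic box *)

Section space.
Context {R : realType}.
Local Notation X := 'rV[R]_3.
Implicit Types (F f g : X -> R) (p : X) (i j : 'I_3) (x y z t : R).

Lemma sum3 (V : nmodType) (F : 'I_3 -> V) : \sum_(i < 3) F i = F 0 + F 1 + F 2.
Proof.
rewrite !big_ord_recr big_ord0 /= add0r.
by congr (F _ + F _ + F _); apply: val_inj.
Qed.

Lemma ord3P (P : 'I_3 -> Prop) : P 0 -> P 1 -> P 2 -> forall i, P i.
Proof.
move=> P0 P1 P2 [[|[|[|//]]] h].
- by rewrite (_ : Ordinal h = 0)//; exact: val_inj.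
- by rewrite (_ : Ordinal h = 1)//; exact: val_inj.
- by rewrite (_ : Ordinal h = 2)//; exact: val_inj.
Qed.

Lemma point3_eta p : point3 (p 0 0) (p 0 1) (p 0 2) = p.
Proof.
by apply/rowP => i; rewrite mxE; move: i; apply: ord3P.
Qed.

Lemma point3_coord x y z :
  (point3 x y z 0 0 = x) * (point3 x y z 0 1 = y) * (point3 x y z 0 2 = z).
Proof. by rewrite !mxE. Qed.

(** Reduces directional derivatives to derivatives of functions of one
    variable. *)
Lemma is_derive_line F p u q t (d : R) : p = q + t *: u ->
  is_derive p u F d <-> is_derive t (1 : R) (fun s => F (q + s *: u)) d.
Proof.
move=> ->.
have E : (fun h : R => h^-1 *: ((F \o shift (q + t *: u)) (h *: u) - F (q + t *: u))) =
  (fun h : R => h^-1 *: (((fun s => F (q + s *: u)) \o shift t) (h *: (1 : R)) - F (q + t *: u))).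
  apply/funext => h /=; congr (_ *: (F _ - _)).
  by rewrite [h *: (1 : R)]mulr1 scalerDl addrCA.
split=> -[d1 d2]; apply: DeriveDef.
- by move: d1; rewrite /derivable E.
- by move: d2; rewrite /derive E.
- by move: d1; rewrite /derivable E.
- by move: d2; rewrite /derive E.
Qed.

Lemma is_derive_comp1 (h : R -> R) F p u (a b : R) :
  is_derive (F p) (1 : R) h a -> is_derive p u F b -> is_derive p u (fun q => h (F q)) (a * b).
Proof.
have e : p = p + 0 *: u by rewrite scale0r addr0.
move=> dh /(is_derive_line _ _ e) dF; apply/(is_derive_line _ _ e).
by apply: (@is_derive1_comp _ h (fun s => F (p + s *: u)) 0 a b) => //; rewrite -e.
Qed.

(** Existence and value of a partial derivative at every point. *)
Definition pd j F f := forall p, is_derive p (basis3 R j) F (f p).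

Lemma line_point3 j x y z t : point3 x y z + t *: basis3 R j =
  point3 (x + t * (j == 0)%:R) (y + t * (j == 1)%:R) (z + t * (j == 2)%:R).
Proof.
by apply/rowP; apply: ord3P; rewrite !mxE /= ?eqxx /= [_ == _]eq_sym.
Qed.

Lemma pd_x F f x y z : pd 0 F f ->
  is_derive x (1 : R) (fun x => F (point3 x y z)) (f (point3 x y z)).
Proof.
move=> dF.
have e : point3 x y z = point3 0 y z + x *: basis3 R 0.
  by rewrite line_point3 /= !mulr1 !mulr0 !addr0 add0r.
have /(is_derive_line _ _ e) := dF (point3 x y z).
by under eq_fun do rewrite line_point3 /= mulr1 !mulr0 !addr0 add0r.
Qed.

Lemma pd_y F f x y z : pd 1 F f ->
  is_derive y (1 : R) (fun y => F (point3 x y z)) (f (point3 x y z)).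
Proof.
move=> dF.
have e : point3 x y z = point3 x 0 z + y *: basis3 R 1.
  by rewrite line_point3 /= !mulr1 !mulr0 !addr0 add0r.
have /(is_derive_line _ _ e) := dF (point3 x y z).
by under eq_fun do rewrite line_point3 /= mulr1 !mulr0 !addr0 add0r.
Qed.

Lemma pd_z F f x y z : pd 2 F f ->
  is_derive z (1 : R) (fun z => F (point3 x y z)) (f (point3 x y z)).
Proof.
move=> dF.
have e : point3 x y z = point3 x y 0 + z *: basis3 R 2.
  by rewrite line_point3 /= !mulr1 !mulr0 !addr0 add0r.
have /(is_derive_line _ _ e) := dF (point3 x y z).
by under eq_fun do rewrite line_point3 /= mulr1 !mulr0 !addr0 add0r.
Qed.

Lemma pd0_intro F f : (forall x y z,
  is_derive x (1 : R) (fun x => F (point3 x y z)) (f (point3 x y z))) -> pd 0 F f.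
Proof.
move=> dF p; rewrite -(point3_eta p).
move: (p 0 0) (p 0 1) (p 0 2) => x y z.
have e : point3 x y z = point3 0 y z + x *: basis3 R 0.
  by rewrite line_point3 /= !mulr1 !mulr0 !addr0 add0r.
apply/(is_derive_line _ _ e).
by under eq_fun do rewrite line_point3 /= mulr1 !mulr0 !addr0 add0r.
Qed.

Lemma pd1_intro F f : (forall x y z,
  is_derive y (1 : R) (fun y => F (point3 x y z)) (f (point3 x y z))) -> pd 1 F f.
Proof.
move=> dF p; rewrite -(point3_eta p).
move: (p 0 0) (p 0 1) (p 0 2) => x y z.
have e : point3 x y z = point3 x 0 z + y *: basis3 R 1.
  by rewrite line_point3 /= !mulr1 !mulr0 !addr0 add0r.
apply/(is_derive_line _ _ e).
by under eq_fun do rewrite line_point3 /= mulr1 !mulr0 !addr0 add0r.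
Qed.

Lemma pd2_intro F f : (forall x y z,
  is_derive z (1 : R) (fun z => F (point3 x y z)) (f (point3 x y z))) -> pd 2 F f.
Proof.
move=> dF p; rewrite -(point3_eta p).
move: (p 0 0) (p 0 1) (p 0 2) => x y z.
have e : point3 x y z = point3 x y 0 + z *: basis3 R 2.
  by rewrite line_point3 /= !mulr1 !mulr0 !addr0 add0r.
apply/(is_derive_line _ _ e).
by under eq_fun do rewrite line_point3 /= mulr1 !mulr0 !addr0 add0r.
Qed.

Lemma pdD j F f G g : pd j F f -> pd j G g ->
  pd j (fun p => F p + G p) (fun p => f p + g p).
Proof. by move=> dF dG p; have dFp := dF p; have dGp := dG p; exact: is_deriveD. Qed.

Lemma pdN j F f : pd j F f -> pd j (fun p => - F p) (fun p => - f p).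
Proof. by move=> dF p; have dFp := dF p; exact: is_deriveN. Qed.

Lemma pdM j F f G g : pd j F f -> pd j G g ->
  pd j (fun p => F p * G p) (fun p => f p * G p + F p * g p).
Proof.
move=> dF dG p; have dFp := dF p; have dGp := dG p.
by apply: is_derive_eq; rewrite /GRing.scale/=; ring.
Qed.

Lemma pd_cst j (c : R) : pd j (fun=> c) (fun=> 0).
Proof. by move=> p; exact: is_derive_cst. Qed.

Lemma pd_coord j i : pd j (fun p => p 0 i) (fun=> (j == i)%:R).
Proof.
move=> p; have e : p = p + 0 *: basis3 R j by rewrite scale0r addr0.
apply/(is_derive_line _ _ e).
have -> : (fun s => (p + s *: basis3 R j) 0 i) = (fun s => p 0 i + s * (j == i)%:R).
  by apply/funext => s; rewrite !mxE eqxx [i == j]eq_sym.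
have h := is_derive_scaler ((j == i)%:R : R) 0.
by apply: is_derive_eq; rewrite add0r mul1r.
Qed.

Lemma pd_eq j F f g : pd j F f -> f =1 g -> pd j F g.
Proof. by move=> dF fg p; rewrite -fg. Qed.

Lemma continuous_point3 (T : topologicalType) (a b c : T -> R) :
  continuous a -> continuous b -> continuous c ->
  continuous (fun s => point3 (a s) (b s) (c s)).
Proof.
move=> ca cb cc s; apply/cvgrPdist_le => e e0.
have /cvgrPdist_le/(_ _ e0) ha := ca s.
have /cvgrPdist_le/(_ _ e0) hb := cb s.
have /cvgrPdist_le/(_ _ e0) hc := cc s.
near=> r; rewrite /Num.Def.normr/= mx_normrE (bigmax_le _ (ltW e0))//= => -[i j] _.
rewrite ord1 !mxE/=; move: j; apply: ord3P => /=.
- by near: r.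
- by near: r.
- by near: r.
Unshelve. all: by end_near. Qed.

Lemma cont3_point3 F : continuous F -> cont3 (fun x y z => F (point3 x y z)).
Proof.
move=> cF; apply: (cont_comp cF); apply: continuous_point3.
- by move=> q; apply: (@cvg_comp _ _ _ fst fst _ (nbhs q.1)); exact: cvg_fst.
- by move=> q; apply: (@cvg_comp _ _ _ fst snd _ (nbhs q.1)); [exact: cvg_fst|exact: cvg_snd].
- exact: cont_snd.
Qed.

Lemma cont_coord i : continuous (fun p : X => p 0 i).
Proof. exact: coord_continuous. Qed.

Definition boxX (a : R) F := box a (fun x y z => F (point3 x y z)).

(** The divergence theorem for a single component: lateral faces contribute
    nothing because F vanishes there, horizontal ones because they cancel. *)
Lemma boxX_pd a j F f : 0 < a -> continuous F -> continuous f -> pd j F f ->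
  (j != 2 -> forall p, `|p 0 j| = a -> F p = 0) ->
  (j = 2 -> forall x y, F (point3 x y 1) = F (point3 x y 0)) ->
  boxX a f = 0.
Proof.
move=> a0 cF cf; move: j; apply: ord3P => dF bF pF.
- apply: (@box_dx _ a (fun x y z => F (point3 x y z))) => //; try exact: cont3_point3.
    by move=> x y z; exact: pd_x.
  by move=> y z; rewrite !bF// point3_coord ?normrN gtr0_norm.
- apply: (@box_dy _ a (fun x y z => F (point3 x y z))) => //; try exact: cont3_point3.
    by move=> x y z; exact: pd_y.
  by move=> y z; rewrite !bF// point3_coord ?normrN gtr0_norm.
- apply: (@box_dz _ a (fun x y z => F (point3 x y z))) => //; try exact: cont3_point3.
    by move=> x y z; exact: pd_z.
  by move=> x y; exact: pF.
Qed.

End space.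

(** * A chain rule and the truncation profile *)

Section chain.
Context {R : realType}.
Local Notation X := 'rV[R]_3.

Lemma cvg_comp_pair (T : Type) (Y Z W : topologicalType) (F : set_system T)
    (FF : Filter F) (h : Y -> Z -> W) (f : T -> Y) (g : T -> Z) (y : Y) (z : Z) :
  continuous (fun p : Y * Z => h p.1 p.2) ->
  f t @[t --> F] --> y -> g t @[t --> F] --> z -> h (f t) (g t) @[t --> F] --> h y z.
Proof.
move=> ch fy gz.
apply: (@cvg_comp _ _ _ (fun t => (f t, g t)) (fun p => h p.1 p.2) F (nbhs (y, z))).
  by apply: cvg_pair; [exact: fy|exact: gz].
exact: (ch (y, z)).
Qed.

Lemma is_derive_cvg (a : R -> R) (t a' : R) : is_derive t (1 : R) a a' ->
  h^-1 * (a (h + t) - a t) @[h --> 0^'] --> a'.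
Proof.
move=> [d1 <-]; rewrite [X in X @ _ --> _](_ : _ =
  (fun h => h^-1 *: ((a \o shift t) (h *: (1 : R)) - a t))); first exact: d1.
by apply/funext => h /=; rewrite [h *: (1 : R)]mulr1.
Qed.

(** Both increments are written with the mean value theorem; continuity of the
    partial derivatives then replaces total differentiability. *)
Lemma is_derive_chain2 (F F1 F2 : R -> R -> R) (a b : R -> R) (t a' b' : R) :
  (forall x y : R, is_derive x (1 : R) (F^~ y) (F1 x y)) ->
  (forall x y : R, is_derive y (1 : R) (F x) (F2 x y)) ->
  continuous (fun p : R * R => F1 p.1 p.2) ->
  continuous (fun p : R * R => F2 p.1 p.2) ->
  is_derive t (1 : R) a a' -> is_derive t (1 : R) b b' ->
  is_derive t (1 : R) (fun s => F (a s) (b s)) (F1 (a t) (b t) * a' + F2 (a t) (b t) * b').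
Proof.
move=> dF1 dF2 c1 c2 da db.
pose u h := a (h + t) - a t; pose v h := b (h + t) - b t.
have /choice[xi xiP] h : exists c, `|c - a t| <= `|u h| /\
    F (a (h + t)) (b (h + t)) - F (a t) (b (h + t)) = F1 c (b (h + t)) * u h.
  have [c c3 c4] := MVT_line (a t) (u h) (fun x => dF1 x (b (h + t))).
  by exists c; split=> //; rewrite -c4 /u subrK.
have /choice[eta etaP] h : exists c, `|c - b t| <= `|v h| /\
    F (a t) (b (h + t)) - F (a t) (b t) = F2 (a t) c * v h.
  have [c c3 c4] := MVT_line (b t) (v h) (dF2 (a t)).
  by exists c; split=> //; rewrite -c4 /v subrK.
have cq (w' : R) (f : R -> R) : is_derive t (1 : R) f w' ->
    `|f (h + t) - f t| @[h --> 0^'] --> (0 : R).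
  move=> df; have cf : {for t, continuous f}.
    by apply: differentiable_continuous; apply/derivable1_diffP; case: df.
  have c0 : h @[h --> (0 : R)^'] --> (0 : R) by apply: cvg_within_filter; apply: cvg_id.
  have c1' : h + t @[h --> (0 : R)^'] --> t.
    by rewrite -[X in _ --> X]add0r; apply: cvgD c0 _; exact: cvg_cst.
  have c2' : f (h + t) @[h --> (0 : R)^'] --> f t by apply: (continuous_cvg _ cf).
  suff : `|f (h + t) - f t| @[h --> (0 : R)^'] --> `|f t - f t| by rewrite subrr normr0.
  by apply: cvg_norm; apply: cvgB c2' _; exact: cvg_cst.
have cxi : xi h @[h --> 0^'] --> a t.
  apply: cvg_zero.
  have := cq a' a da => H.
  apply: norm_cvg0; apply: (@squeeze_cvgr _ _ _ _ (cst 0) _ _ _ _ _ H); last exact: cvg_cst.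
  by apply: nearW => h; rewrite normr_ge0/=; case: (xiP h).
have ceta : eta h @[h --> 0^'] --> b t.
  apply: cvg_zero.
  have := cq b' b db => H.
  apply: norm_cvg0; apply: (@squeeze_cvgr _ _ _ _ (cst 0) _ _ _ _ _ H); last exact: cvg_cst.
  by apply: nearW => h; rewrite normr_ge0/=; case: (etaP h).
have cb : b (h + t) @[h --> 0^'] --> b t.
  apply: cvg_zero; apply: norm_cvg0; exact: cq db.
have L : h^-1 * (F (a (h + t)) (b (h + t)) - F (a t) (b t)) @[h --> 0^'] -->
    (F1 (a t) (b t) * a' + F2 (a t) (b t) * b').
  rewrite [X in X @ _ --> _](_ : _ = (fun h => F1 (xi h) (b (h + t)) * (h^-1 * u h) +
      F2 (a t) (eta h) * (h^-1 * v h))); last first.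
    apply/funext => h; have [_ e1] := xiP h; have [_ e2] := etaP h.
    rewrite -(subrK (F (a t) (b (h + t))) (F (a (h + t)) _)) -addrA e1 e2; ring.
  apply: cvgD; apply: cvgM.
  - exact: (cvg_comp_pair _ c1 cxi cb).
  - exact: is_derive_cvg.
  - exact: (cvg_comp_pair _ c2 (cvg_cst _) ceta).
  - exact: is_derive_cvg.
apply: is_derive_lim => e e0.
move/cvgrPdist_le : L => /(_ e e0); apply: filterS => h.
by rewrite distrC.
Qed.

Definition pos (x : R) : R := Num.max 0 x.

Lemma pos_ge0 x : 0 <= pos x. Proof. by rewrite /pos le_max lexx. Qed.

Lemma cont_pos : continuous pos.
Proof.
move=> x; rewrite /pos.
have -> : (fun y : R => Num.max 0 y) = (fun y => (y + `|y|) / 2).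
  apply/funext => y; have [y0|y0] := ltP 0 y; first by rewrite gtr0_norm//; lra.
  by rewrite ler0_norm//; lra.
have : continuous (fun y : R => (y + `|y|) / 2).
  apply: contM; last exact: cont_cst.
  by apply: contD; [exact: cont_id|apply: cont_norm; exact: cont_id].
exact.
Qed.

(** Squares and higher powers of the positive part are continuously
    differentiable: at 0 the difference quotient is O(h^(n+1)). *)
Lemma is_derive_pos n (x : R) :
  is_derive x (1 : R) (fun y => pos y ^+ n.+2) (n.+2%:R * pos x ^+ n.+1).
Proof.
have [x0|x0|<-] := ltgtP 0 x.
- have px : pos x = x by rewrite /pos max_r// ltW.
  apply: (@near_eq_is_derive R R R (fun y => y ^+ n.+2) (fun y => pos y ^+ n.+2) x 1).
    have : \forall y \near x, 0 < y by exact: lt_nbhsr.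
    by apply: filterS => y y0; rewrite /pos max_r// ltW.
  have e : (fun y : R => y ^+ n.+2) = id ^+ n.+2 by apply/funext => y; rewrite exprfctE.
  by rewrite px e; apply: is_derive_eq; rewrite [_ *: _]mulr1.
- have px : pos x = 0 by rewrite /pos max_l// ltW.
  apply: (@near_eq_is_derive R R R (fun=> 0) (fun y => pos y ^+ n.+2) x 1).
    have : \forall y \near x, y < 0 by exact: lt_nbhsl.
    by apply: filterS => y y0; rewrite /pos max_l ?expr0n//= ltW.
  by rewrite px expr0n/= mulr0; exact: is_derive_cst.
- have p0 : pos 0 = 0 by rewrite /pos maxxx.
  rewrite p0 expr0n/= mulr0; apply: is_derive_lim => e e0; near=> h.
  rewrite addr0 p0 expr0n/= !subr0.
  have h0 : h != 0 by near: h; exact: nbhs_dnbhs_neq.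
  have h1 : `|h| < 1 by near: h; exact: dnbhs0_lt.
  have he : `|h| < e by near: h; exact: dnbhs0_lt.
  have ph : pos h <= `|h| by rewrite /pos ge_max normr_ge0 ler_norm.
  have ph0 := pos_ge0 h.
  rewrite normrM normrX normfV (ger0_norm ph0) -ler_pdivlMl ?invr_gt0 ?normr_gt0// invrK.
  rewrite exprS; apply: ler_pM => //; first exact: exprn_ge0.
  rewrite exprS (le_trans _ (ltW he))// (le_trans _ ph)// ler_piMr//.
  by rewrite exprn_ile1// (le_trans ph (ltW h1)).
Unshelve. all: by end_near. Qed.

End chain.

(** * The radial flux has zero vertical mean *)

Section zprim.
Context {R : realType}.
Local Notation X := 'rV[R]_3.
Implicit Types (F f g : X -> R) (p : X).

Definition zprim F p := prim (fun t => F (point3 (p 0 0) (p 0 1) t)) (p 0 2).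

Lemma zprimE F x y z : zprim F (point3 x y z) =
  z * itg 0 1 (fun t => F (point3 x y (t * z))).
Proof. by rewrite /zprim /prim !point3_coord. Qed.

Lemma continuous_zprim F : continuous F -> continuous (zprim F).
Proof.
move=> cF; rewrite /zprim /prim; apply: contM; first exact: cont_coord.
apply: (@continuous_itg _ X (fun p t => F (point3 (p 0 0) (p 0 1) (t * p 0 2))) _ _ ltr01).
apply: (cont_comp cF); apply: continuous_point3.
- by apply: (@cont_fst_comp _ _ _ (fun p : X => p 0 0)); exact: cont_coord.
- by apply: (@cont_fst_comp _ _ _ (fun p : X => p 0 1)); exact: cont_coord.
- apply: contM; first exact: cont_snd.
  by apply: (@cont_fst_comp _ _ _ (fun p : X => p 0 2)); exact: cont_coord.
Qed.

Lemma pd_zprim_z F f : continuous f -> pd 2 F f -> pd 2 (zprim F) F.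
Proof.
move=> cf dF; apply: pd2_intro => x y z; rewrite /zprim.
have -> : (fun z0 => prim (fun t => F (point3 (point3 x y z0 0 0) (point3 x y z0 0 1) t))
     (point3 x y z0 0 2)) = prim (fun t => F (point3 x y t)).
  by apply/funext => u; rewrite !point3_coord.
apply: (@is_derive_prim _ (fun t => F (point3 x y t)) (fun t => f (point3 x y t))).
  exact: cont3_z (cont3_point3 cf).
by move=> t; exact: pd_z.
Qed.

Lemma pd_zprim_x F f : continuous F -> continuous f -> pd 0 F f -> pd 0 (zprim F) (zprim f).
Proof.
move=> cF cf dF; apply: pd0_intro => x y z; rewrite zprimE.
under eq_fun do rewrite zprimE.
have c3 (g : X -> R) : continuous g -> continuous (fun p : R * R => g (point3 p.1 y (p.2 * z))).
  move=> cg; apply: (cont_comp cg); apply: continuous_point3.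
  - exact: cont_fst.
  - exact: cont_cst.
  - by apply: contM; [exact: cont_snd|exact: cont_cst].
have h : is_derive x (1 : R) (fun x => itg 0 1 (fun t => F (point3 x y (t * z))))
    (itg 0 1 (fun t => f (point3 x y (t * z)))).
  apply: (@is_derive_itg _ (fun x t => F (point3 x y (t * z)))
    (fun x t => f (point3 x y (t * z))) _ _ ltr01).
  - by move=> u t; exact: pd_x.
  - move=> u; apply: (cont_comp cF); apply: continuous_point3;
      by [exact: cont_cst|exact: cont_scale].
  - exact: c3.
by apply: is_derive_eq; rewrite /GRing.scale/= ?mulr0 ?addr0.
Qed.

Lemma pd_zprim_y F f : continuous F -> continuous f -> pd 1 F f -> pd 1 (zprim F) (zprim f).
Proof.
move=> cF cf dF; apply: pd1_intro => x y z; rewrite zprimE.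
under eq_fun do rewrite zprimE.
have c3 (g : X -> R) : continuous g -> continuous (fun p : R * R => g (point3 x p.1 (p.2 * z))).
  move=> cg; apply: (cont_comp cg); apply: continuous_point3.
  - exact: cont_cst.
  - exact: cont_fst.
  - by apply: contM; [exact: cont_snd|exact: cont_cst].
have h : is_derive y (1 : R) (fun y => itg 0 1 (fun t => F (point3 x y (t * z))))
    (itg 0 1 (fun t => f (point3 x y (t * z)))).
  apply: (@is_derive_itg _ (fun y t => F (point3 x y (t * z)))
    (fun y t => f (point3 x y (t * z))) _ _ ltr01).
  - by move=> u t; exact: pd_y.
  - move=> u; apply: (cont_comp cF); apply: continuous_point3;
      by [exact: cont_cst|exact: cont_scale].
  - exact: c3.
by apply: is_derive_eq; rewrite /GRing.scale/= ?mulr0 ?addr0.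
Qed.

Lemma zprim0 F x y : zprim F (point3 x y 0) = 0.
Proof. by rewrite zprimE mul0r. Qed.

Lemma zprim1 F x y : zprim F (point3 x y 1) = itg 0 1 (fun t => F (point3 x y t)).
Proof. by rewrite zprimE mul1r; apply: eq_itg => t _; rewrite mulr1. Qed.

Lemma zprim_le F f x y z : continuous F -> continuous f ->
  (forall t, `|F (point3 x y t)| <= f (point3 x y t)) -> 0 <= z <= 1 ->
  `|zprim F (point3 x y z)| <= itg 0 1 (fun t => f (point3 x y t)).
Proof.
move=> cF cf Ff z01; rewrite /zprim !point3_coord; apply: prim_le => //.
- exact: cont3_z (cont3_point3 cF).
- exact: cont3_z (cont3_point3 cf).
Qed.

End zprim.

Section mean.
Context {R : realType}.
Local Notation X := 'rV[R]_3.
(** D j i stands for d_j v_i.  The last hypothesis says that r v_theta has zero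
    derivative along horizontal circles. *)
Context (v : 'I_3 -> X -> R) (D : 'I_3 -> 'I_3 -> X -> R).
Context (cv : forall i, continuous (v i)) (cD : forall j i, continuous (D j i)).
Context (pdv : forall j i, pd j (v i) (D j i)).
Context (div : forall p, D 0 0 p + D 1 1 p + D 2 2 p = 0).
Context (per : forall x y, v 2 (point3 x y 1) = v 2 (point3 x y 0)).
Context (rot : forall p : X,
  p 0 0 * (- v 0 p - p 0 1 * D 1 0 p + p 0 0 * D 1 1 p) =
  p 0 1 * (- p 0 1 * D 0 0 p + v 1 p + p 0 0 * D 0 1 p)).

Definition flux (p : X) : R := p 0 0 * v 0 p + p 0 1 * v 1 p.
Definition dflux (j : 'I_3) (p : X) : R :=
  (j == 0)%:R * v 0 p + p 0 0 * D j 0 p + ((j == 1)%:R * v 1 p + p 0 1 * D j 1 p).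

Lemma continuous_flux : continuous flux.
Proof. by apply: contD; apply: contM; by [exact: cont_coord|exact: cv]. Qed.

Lemma continuous_dflux j : continuous (dflux j).
Proof.
apply: contD; apply: contD; apply: contM;
  by [exact: cont_coord|exact: cv|exact: cD|exact: cont_cst].
Qed.

Lemma pd_flux j : pd j flux (dflux j).
Proof. by apply: pdD; apply: pdM => //; exact: pd_coord. Qed.

(** Along the segment from the axis to (x, y) the mean m(tx, ty) has derivative
    d(t) with t d(t) = - r^2 (v_3(z = 1) - v_3(z = 0)) = 0, where r^2 is taken
    at (tx, ty).  The mean value theorem on [0, 1] uses only one t > 0, so that
    the division by t is harmless. *)
Lemma mean_flux0 x y : itg 0 1 (fun t => flux (point3 x y t)) = 0.
Proof.
pose m (x y : R) := zprim flux (point3 x y 1).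
pose m0 (x y : R) := zprim (dflux 0) (point3 x y 1).
pose m1 (x y : R) := zprim (dflux 1) (point3 x y 1).
have c2 (F : X -> R) : continuous F -> continuous (fun p : R * R => F (point3 p.1 p.2 1)).
  move=> cF; apply: (cont_comp cF).
  by apply: continuous_point3; [exact: cont_fst|exact: cont_snd|exact: cont_cst].
have dm0 x' y' : is_derive x' (1 : R) (m^~ y') (m0 x' y').
  apply: (@pd_x _ (zprim flux)); apply: pd_zprim_x; last exact: pd_flux.
  - exact: continuous_flux.
  - exact: continuous_dflux.
have dm1 x' y' : is_derive y' (1 : R) (m x') (m1 x' y').
  apply: (@pd_y _ (zprim flux)); apply: pd_zprim_y; last exact: pd_flux.
  - exact: continuous_flux.
  - exact: continuous_dflux.
have cm0 : continuous (fun p : R * R => m0 p.1 p.2).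
  exact/(c2 (zprim (dflux 0)))/continuous_zprim/continuous_dflux.
have cm1 : continuous (fun p : R * R => m1 p.1 p.2).
  exact/(c2 (zprim (dflux 1)))/continuous_zprim/continuous_dflux.
(* The derivative along the segment of m(tx, ty), by the chain rule. *)
pose d t := m0 (t * x) (t * y) * x + m1 (t * x) (t * y) * y.
have dt (t : R) : is_derive t (1 : R) (fun t => m (t * x) (t * y)) (d t).
  by apply: (is_derive_chain2 dm0 dm1 cm0 cm1); exact: is_derive_scaler.
have td t : t * d t = 0.
  have -> : t * d t = (t * x) * m0 (t * x) (t * y) + (t * y) * m1 (t * x) (t * y).
    by rewrite /d; ring.
  move: (t * x) (t * y) => x' y'; rewrite /m0 /m1 !zprim1.
  have cz j : continuous (fun s : R => dflux j (point3 x' y' s)).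
    exact: (@cont3_z _ (fun x y z => dflux j (point3 x y z)) x' y'
      (cont3_point3 (@continuous_dflux j))).
  have cD2 : continuous (fun s : R => D 2 2 (point3 x' y' s)).
    exact: (@cont3_z _ (fun x y z => D 2 2 (point3 x y z)) x' y'
      (cont3_point3 (@cD 2 2))).
  rewrite -!itgZ// -itgD; last 2 first.
  - by apply: contM; [exact: cont_cst|exact: cz].
  - by apply: contM; [exact: cont_cst|exact: cz].
  rewrite (@eq_itg _ 0 1 _ (fun s => - (x' ^+ 2 + y' ^+ 2) * D 2 2 (point3 x' y' s))).
    rewrite itgZ// (itg_FTC ltr01 _ (fun s _ => pd_z x' y' s (pdv 2 2)))//.
    by rewrite per subrr mulr0.
  move=> s _; have := rot (point3 x' y' s); have := div (point3 x' y' s).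
  rewrite /dflux !point3_coord /= => e1 e2.
  have -> : D 2 2 (point3 x' y' s) = - D 0 0 (point3 x' y' s) - D 1 1 (point3 x' y' s).
    by move: e1 => /eqP; rewrite -addrA addrCA addrC; lra.
  lra.
have cm : continuous (fun t : R => m (t * x) (t * y)) by exact: is_derive_continuous dt.
have [c] := @MVT _ _ d 0 1 ltr01 (fun t _ => dt t) (continuous_subspaceT cm).
rewrite in_itv/= => /andP[c0 c1].
have -> : d c = 0 by have /eqP := td c; rewrite mulf_eq0 gt_eqF//= => /eqP.
rewrite mul0r !mul1r !mul0r {1 2}/m !zprim1 => /eqP; rewrite subr_eq0 => /eqP ->.
rewrite -[RHS](mul0r (1 - 0)) -itg_cst//; apply: eq_itg => t _.
by rewrite /flux !point3_coord !mul0r addr0.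
Qed.

End mean.

(** * Radial cut-off functions *)

Section cutoff.
Context {R : realType}.
Local Notation X := 'rV[R]_3.
Context (a : R) (a0 : 0 < a).
Implicit Types (p : X) (j : 'I_3).

(** The components of the horizontal position vector (x, y, 0). *)
Definition hcoord j p : R := if j == 2 then 0 else p 0 j.

Definition bump p : R := pos (1 - (p 0 0 ^+ 2 + p 0 1 ^+ 2) / a ^+ 2).
Definition cut0 p : R := bump p ^+ 3.
(** cut1 and cut2 are the radial factors of the gradients: grad cut0 and
    grad cut1 are cut1 and cut2 times the horizontal position vector. *)
Definition cut1 p : R := - (6 / a ^+ 2) * bump p ^+ 2.
Definition cut2 p : R := 24 / a ^+ 4 * bump p.

Lemma continuous_bump : continuous bump.
Proof.
apply: (cont_comp cont_pos); apply: contB; first exact: cont_cst.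
apply: contM; last exact: cont_cst.
by apply: contD; apply: contX; exact: cont_coord.
Qed.

Lemma continuous_hcoord j : continuous (hcoord j).
Proof. by rewrite /hcoord; case: (j == 2); [exact: cont_cst|exact: cont_coord]. Qed.

Lemma pd_bump n j : pd j (fun p => bump p ^+ n.+2)
  (fun p => n.+2%:R * bump p ^+ n.+1 * (- (2 / a ^+ 2) * hcoord j p)).
Proof.
have an0 : a != 0 by exact: lt0r_neq0.
have ds : pd j (fun p => 1 - (p 0 0 * p 0 0 + p 0 1 * p 0 1) * (a ^+ 2)^-1)
    (fun p => - (2 / a ^+ 2) * hcoord j p).
  apply: pd_eq.
    apply: pdD; first exact: pd_cst.
    apply: pdN; apply: pdM; last exact: pd_cst.
    by apply: pdD; apply: pdM; exact: pd_coord.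
  move=> p; rewrite /hcoord; move: j; apply: ord3P => /=; by field.
have e : (fun p : X => 1 - (p 0 0 * p 0 0 + p 0 1 * p 0 1) * (a ^+ 2)^-1) =
    (fun p : X => 1 - (p 0 0 ^+ 2 + p 0 1 ^+ 2) / a ^+ 2).
  by apply/funext => p; rewrite !expr2.
rewrite e in ds; move=> p; have dsp := ds p.
apply: (@is_derive_comp1 _ (fun y => pos y ^+ n.+2)
  (fun p => 1 - (p 0 0 ^+ 2 + p 0 1 ^+ 2) / a ^+ 2)).
exact: is_derive_pos.
Qed.

Lemma pd_cut0 j : pd j cut0 (fun p => cut1 p * hcoord j p).
Proof.
have an0 : a != 0 by exact: lt0r_neq0.
by apply: pd_eq (@pd_bump 1 j) _ => p; rewrite /cut1; field.
Qed.

Lemma pd_cut1 j : pd j cut1 (fun p => cut2 p * hcoord j p).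
Proof.
have an0 : a != 0 by exact: lt0r_neq0.
apply: pd_eq; first by apply: pdM; [exact: pd_cst|exact: (@pd_bump 0 j)].
by move=> p; rewrite /cut2; field.
Qed.

Lemma continuous_cut0 : continuous cut0.
Proof. by apply: contX; exact: continuous_bump. Qed.
Lemma continuous_cut1 : continuous cut1.
Proof. by apply: contM; [exact: cont_cst|apply: contX; exact: continuous_bump]. Qed.
Lemma continuous_cut2 : continuous cut2.
Proof. by apply: contM; [exact: cont_cst|exact: continuous_bump]. Qed.

Lemma bump_bnd j p : j != 2 -> `|p 0 j| = a -> bump p = 0.
Proof.
move=> j2 pj; have a2 : 0 < a ^+ 2 by exact: exprn_gt0.
rewrite /bump /pos max_l// subr_le0 ler_pdivlMr// mul1r.
have e : p 0 j ^+ 2 = a ^+ 2 by rewrite -pj real_normK// num_real.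
rewrite -e; move: j j2 {pj e}; apply: ord3P => //= _.
  by rewrite lerDl sqr_ge0.
by rewrite lerDr sqr_ge0.
Qed.

Lemma bump_ge0 p : 0 <= bump p. Proof. exact: pos_ge0. Qed.

Lemma bump_le1 p : bump p <= 1.
Proof.
rewrite /bump /pos ge_max ler01/= gerDl oppr_le0.
by apply: divr_ge0; rewrite ?addr_ge0 ?sqr_ge0.
Qed.

Lemma cut0_ge p c : 0 < c -> c *+ 2 <= a -> `|p 0 0| <= c -> `|p 0 1| <= c ->
  1 / 8 <= cut0 p.
Proof.
move=> c0 ca x_c y_c; have a2 : 0 < a ^+ 2 by exact: exprn_gt0.
have : 1 / 2 <= bump p.
  rewrite /bump /pos le_max; apply/orP; right.
  suff : (p 0 0 ^+ 2 + p 0 1 ^+ 2) / a ^+ 2 <= 1 / 2 by lra.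
  rewrite ler_pdivrMr//.
  have hx : p 0 0 ^+ 2 <= c ^+ 2.
    by rewrite -real_normK ?num_real// ler_pXn2r ?nnegrE// ltW.
  have hy : p 0 1 ^+ 2 <= c ^+ 2.
    by rewrite -real_normK ?num_real// ler_pXn2r ?nnegrE// ltW.
  have c20 : 0 <= c *+ 2 by apply: mulrn_wge0; exact: ltW.
  have : (c *+ 2) ^+ 2 <= a ^+ 2 by rewrite ler_pXn2r ?nnegrE ?(ltW a0).
  by rewrite -mulr_natr; lra.
move=> hb; rewrite /cut0.
have -> : 1 / 8 = (1 / 2) ^+ 3 :> R by field.
by rewrite ler_pXn2r ?nnegrE ?bump_ge0//; lra.
Qed.

Lemma cut0_le1 p : 0 <= cut0 p <= 1.
Proof.
by rewrite exprn_ge0 ?bump_ge0// exprn_ile1 ?bump_ge0 ?bump_le1.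
Qed.

Lemma norm_cut1 p : `|cut1 p| <= 6 / a ^+ 2.
Proof.
have h : 0 <= 6 / a ^+ 2 by rewrite divr_ge0 ?exprn_ge0 ?ltW.
rewrite /cut1 normrM normrN (ger0_norm h) ler_piMr//.
by rewrite normrX ger0_norm ?bump_ge0// exprn_ile1 ?bump_ge0 ?bump_le1.
Qed.

Lemma norm_cut2 p : `|cut2 p| <= 24 / a ^+ 4.
Proof.
have h : 0 <= 24 / a ^+ 4 by rewrite divr_ge0 ?exprn_ge0 ?ltW.
by rewrite /cut2 normrM (ger0_norm h) ler_piMr// ger0_norm ?bump_ge0 ?bump_le1.
Qed.

End cutoff.

Section boxX.
Context {R : realType}.
Local Notation X := 'rV[R]_3.
Implicit Types (F G : X -> R) (a : R).

Lemma boxXD a F G : 0 < a -> continuous F -> continuous G ->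
  boxX a (fun p => F p + G p) = boxX a F + boxX a G.
Proof. by move=> a0 cF cG; apply: boxD => //; exact: cont3_point3. Qed.

Lemma boxXZ a c F : 0 < a -> continuous F -> boxX a (fun p => c * F p) = c * boxX a F.
Proof.
move=> a0 cF; apply: (@boxZ _ a c (fun x y z => F (point3 x y z))) => //.
exact: cont3_point3.
Qed.

(** Cauchy-Schwarz on the unit interval, from the variance of g. *)
Lemma itg_sq (g : R -> R) : continuous g ->
  itg 0 1 g * itg 0 1 g <= itg 0 1 (fun t => g t * g t).
Proof.
move=> cg; set c := itg 0 1 g.
have cgg : continuous (fun t => g t * g t) by exact: contM.
have : 0 <= itg 0 1 (fun t => (g t * g t + (- 2 * c) * g t) + c * c).
  apply: itg_ge0 => t _.
  have -> : g t * g t + (- 2 * c) * g t + c * c = (g t - c) ^+ 2 by ring.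
  exact: sqr_ge0.
have c1 : continuous (fun t => (- 2 * c) * g t) by apply: contM; [exact: cont_cst|].
rewrite itgD; [|exact: contD|exact: cont_cst].
rewrite itg_cst ?ltr01// itgD// itgZ// -/c; lra.
Qed.

(** On each vertical segment the left-hand integral is the square of the mean
    of G. *)
Lemma box_mean a G : 0 < a -> continuous G ->
  box a (fun x y z => G (point3 x y z) * itg 0 1 (fun t => G (point3 x y t))) <=
  boxX a (fun p => G p * G p).
Proof.
move=> a0 cG.
have c3 := cont3_point3 cG.
pose GG x y z := G (point3 x y z) * G (point3 x y z).
pose Gm x y z := G (point3 x y z) * itg 0 1 (fun t => G (point3 x y t)).
have cGG : cont3 GG by exact: contM.
have cM : continuous (fun p : R * R => itg 0 1 (fun t => G (point3 p.1 p.2 t))).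
  exact: (cont_itg1 c3).
have cm : cont3 Gm.
  apply: contM => //; apply: (@cont_fst_comp _ _ _
    (fun p : R * R => itg 0 1 (fun t => G (point3 p.1 p.2 t)))).
  exact: cM.
apply: (@le_itg _ _ _ (fun x => itg (-a) a (fun y => itg 0 1 (Gm x y)))
  (fun x => itg (-a) a (fun y => itg 0 1 (GG x y)))); [exact: cont_itg2..|move=> x _].
apply: (@le_itg _ _ _ (fun y => itg 0 1 (Gm x y)) (fun y => itg 0 1 (GG x y)));
  [exact: cont_itg1y..|move=> y _].
have cz : continuous (fun t : R => G (point3 x y t)).
  exact: (@cont3_z _ (fun x y z => G (point3 x y z)) x y).
rewrite /Gm; under eq_itg do rewrite mulrC.
by rewrite itgZ//; exact: itg_sq.
Qed.

End boxX.

(** * The localized energy inequality *)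

Ltac cont_step :=
  lazymatch goal with
  | |- (forall x, continuous_at x (fun p => (@?A p + @?B p)%R)) =>
      refine (@contD _ _ A B _ _)
  | |- (forall x, continuous_at x (fun p => (- (@?A p))%R)) =>
      refine (@contN _ _ A _)
  | |- (forall x, continuous_at x (fun p => (@?A p * @?B p)%R)) =>
      refine (@contM _ _ A B _ _)
  | |- (forall x, continuous_at x (fun p => ?c)) => exact (@cont_cst _ _ c)
  end.

Ltac cont_eta :=
  lazymatch goal with
  | |- (forall x, continuous_at x (fun p => ?g p)) => change (continuous g)
  end.

Lemma normM_le (R : realType) (x y X Y : R) : `|x| <= X -> `|y| <= Y -> `|x * y| <= X * Y.
Proof. by move=> xX yY; rewrite normrM; apply: ler_pM. Qed.

Lemma normD_le (R : realType) (x y X Y : R) : `|x| <= X -> `|y| <= Y -> `|x + y| <= X + Y.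
Proof. by move=> xX yY; apply: le_trans (ler_normD _ _) _; exact: lerD. Qed.

Section grads.
Context {R : realType}.
Local Notation X := 'rV[R]_3.
Context (D : 'I_3 -> 'I_3 -> X -> R).
Implicit Types (p : X) (i j : 'I_3).

Definition gradsq p : R := \sum_(j < 3) \sum_(i < 3) D j i p * D j i p.
Definition grad1 p : R := \sum_(j < 3) \sum_(i < 3) `|D j i p|.

Lemma gradsq_ge0 p : 0 <= gradsq p.
Proof. by apply: sumr_ge0 => j _; apply: sumr_ge0 => i _; rewrite -expr2 sqr_ge0. Qed.

Lemma grad1_ge0 p : 0 <= grad1 p.
Proof. by apply: sumr_ge0 => j _; apply: sumr_ge0. Qed.

Lemma le_grad1 j i p : `|D j i p| <= grad1 p.
Proof.
rewrite /grad1 (bigD1 j)//= (bigD1 i)//= -addrA lerDl addr_ge0//.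
  by apply: sumr_ge0.
by apply: sumr_ge0 => k _; apply: sumr_ge0.
Qed.

Lemma gradsq_eq0 p : gradsq p = 0 -> forall j i, D j i p = 0.
Proof.
move=> S0 j i.
have sq (k l : 'I_3) : 0 <= D k l p * D k l p by rewrite -expr2 sqr_ge0.
have : D j i p * D j i p <= 0.
  rewrite -S0 /gradsq (bigD1 j)//= (bigD1 i)//= -addrA lerDl addr_ge0//.
    by apply: sumr_ge0.
  by apply: sumr_ge0 => k _; apply: sumr_ge0.
by rewrite -expr2 => h; apply/eqP; rewrite -sqrf_eq0; apply/eqP/le_anti; rewrite h sqr_ge0.
Qed.

Lemma sqr_sum3_le (x y z : R) : (x + y + z) ^+ 2 <= 3 * (x ^+ 2 + y ^+ 2 + z ^+ 2).
Proof.
have := sqr_ge0 (x - y); have := sqr_ge0 (y - z); have := sqr_ge0 (x - z).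
by rewrite -subr_ge0; nra.
Qed.

Lemma sqr_grad1_le p : grad1 p * grad1 p <= 9 * gradsq p.
Proof.
rewrite -expr2 /grad1 /gradsq sum3 [in leRHS]sum3.
have h (j : 'I_3) : (\sum_(i < 3) `|D j i p|) ^+ 2 <= 3 * \sum_(i < 3) D j i p * D j i p.
  rewrite !sum3; apply: le_trans (sqr_sum3_le _ _ _) _.
  by rewrite !real_normK ?num_real// !expr2.
apply: le_trans (sqr_sum3_le _ _ _) _.
apply: le_trans (ler_wpM2l _ (lerD (lerD (h 0) (h 1)) (h 2))) _ => //.
by rewrite -!mulrDr mulrA -natrM lexx.
Qed.

Context (cD : forall j i, continuous (D j i)).

Lemma continuous_grad1 : continuous grad1.
Proof.
have -> : grad1 = (fun p => `|D 0 0 p| + `|D 0 1 p| + `|D 0 2 p|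
   + (`|D 1 0 p| + `|D 1 1 p| + `|D 1 2 p|) + (`|D 2 0 p| + `|D 2 1 p| + `|D 2 2 p|)).
  by apply/funext => p; rewrite /grad1 !sum3.
by repeat apply: contD; apply: cont_norm; exact: cD.
Qed.

Lemma continuous_gradsq : continuous gradsq.
Proof.
have -> : gradsq = (fun p => D 0 0 p * D 0 0 p + D 0 1 p * D 0 1 p + D 0 2 p * D 0 2 p
   + (D 1 0 p * D 1 0 p + D 1 1 p * D 1 1 p + D 1 2 p * D 1 2 p)
   + (D 2 0 p * D 2 0 p + D 2 1 p * D 2 1 p + D 2 2 p * D 2 2 p)).
  by apply/funext => p; rewrite /gradsq !sum3.
repeat apply: contD; apply: contM; exact: cD.
Qed.

End grads.

Section energy.
Context {R : realType}.
Local Notation X := 'rV[R]_3.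
(** Here D j i stands for d_j v_i, DD j i for d_j d_j v_i, q for the pressure and
    dq for its gradient. *)
Context (v : 'I_3 -> X -> R) (D DD : 'I_3 -> 'I_3 -> X -> R).
Context (q : X -> R) (dq : 'I_3 -> X -> R) (M : R).
Context (cv : forall i, continuous (v i)) (cD : forall j i, continuous (D j i)).
Context (cDD : forall j i, continuous (DD j i)).
Context (cq : continuous q) (cdq : forall j, continuous (dq j)).
Context (pdv : forall j i, pd j (v i) (D j i)).
Context (pdDv : forall j i, pd j (D j i) (DD j i)).
Context (pdq : forall j, pd j q (dq j)).
Context (div : forall p, D 0 0 p + D 1 1 p + D 2 2 p = 0).
Context (ns : forall i p, v 0 p * D 0 i p + v 1 p * D 1 i p + v 2 p * D 2 i p + dq i p
  - (DD 0 i p + DD 1 i p + DD 2 i p) = 0).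
Context (perv : forall i x y, v i (point3 x y 1) = v i (point3 x y 0)).
Context (perD : forall j i x y, D j i (point3 x y 1) = D j i (point3 x y 0)).
Context (perq : forall x y, q (point3 x y 1) = q (point3 x y 0)).
Context (vM : forall i p, `|v i p| <= M).
Context (rot : forall p : X,
  p 0 0 * (- v 0 p - p 0 1 * D 1 0 p + p 0 0 * D 1 1 p) =
  p 0 1 * (- p 0 1 * D 0 0 p + v 1 p + p 0 0 * D 0 1 p)).

Local Notation gradsq := (gradsq D).
Local Notation grad1 := (grad1 D).

Let head p : R := (v 0 p * v 0 p + v 1 p * v 1 p + v 2 p * v 2 p) * 2^-1 + q p.
Let dhead j p : R := v 0 p * D j 0 p + v 1 p * D j 1 p + v 2 p * D j 2 p + dq j p.
Let work j p : R := v 0 p * D j 0 p + v 1 p * D j 1 p + v 2 p * D j 2 p.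
Let dwork j p : R := D j 0 p * D j 0 p + D j 1 p * D j 1 p + D j 2 p * D j 2 p
  + (v 0 p * DD j 0 p + v 1 p * DD j 1 p + v 2 p * DD j 2 p).
Let w := flux v.
Let Psi := zprim w.
(** The horizontal derivatives pass under the integral sign; the vertical one
    gives back w. *)
Let dPsi j := if j == 2 then w else zprim (dflux v D j).

Let cw : continuous w. Proof. exact: continuous_flux. Qed.
Let cdw j : continuous (dflux v D j). Proof. exact: continuous_dflux. Qed.
Let cPsi : continuous Psi. Proof. exact: continuous_zprim. Qed.
Let cdPsi j : continuous (dPsi j).
Proof. by rewrite /dPsi; case: (j == 2); [exact: cw|exact: continuous_zprim]. Qed.

Let pd_Psi j : pd j Psi (dPsi j).
Proof.
move: j; apply: ord3P; rewrite /dPsi/=.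
- by apply: pd_zprim_x => //; exact: pd_flux.
- by apply: pd_zprim_y => //; exact: pd_flux.
- by apply: (@pd_zprim_z _ _ (dflux v D 2)) => //; exact: pd_flux.
Qed.

Let Psi0 x y : Psi (point3 x y 0) = 0. Proof. exact: zprim0. Qed.
Let Psi1 x y : Psi (point3 x y 1) = 0.
Proof. by rewrite /Psi zprim1; exact: (mean_flux0 cv cD pdv div (perv 2) rot). Qed.

Let pd_head j : pd j head (dhead j).
Proof.
apply: pd_eq.
  apply: pdD; last exact: pdq.
  apply: pdM; last exact: pd_cst.
  by apply: pdD; [apply: pdD|]; apply: pdM; exact: pdv.
by move=> p; rewrite /dhead /=; field.
Qed.

Let pd_work j : pd j (work j) (dwork j).
Proof.
apply: pd_eq.
  by apply: pdD; [apply: pdD|]; apply: pdM; by [exact: pdv|exact: pdDv].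
by move=> p; rewrite /dwork /=; ring.
Qed.

Let chead : continuous head.
Proof.
rewrite /head; repeat cont_step; cont_eta;
  first [exact (@cv _)|exact cq].
Qed.
Let cdhead j : continuous (dhead j).
Proof.
rewrite /dhead; repeat cont_step; cont_eta;
  first [exact (@cv _)|exact (@cD _ _)|exact (@cdq _)].
Qed.
Let cwork j : continuous (work j).
Proof.
rewrite /work; repeat cont_step; cont_eta;
  first [exact (@cv _)|exact (@cD _ _)].
Qed.
Let cdwork j : continuous (dwork j).
Proof.
rewrite /dwork; repeat cont_step; cont_eta;
  first [exact (@cv _)|exact (@cD _ _)|exact (@cDD _ _)].
Qed.

Section radius.
Context (a : R) (a1 : 1 <= a).
Let a0 : 0 < a. Proof. by apply: lt_le_trans a1; exact: ltr01. Qed.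
Let phi := cut0 a.
Let psi := cut1 a.
Let chi := cut2 a.
Let cphi : continuous phi. Proof. exact: continuous_cut0. Qed.
Let cpsi : continuous psi. Proof. exact: continuous_cut1. Qed.
Let cchi : continuous chi. Proof. exact: continuous_cut2. Qed.

(** phi (v . d_j v - Q v_j) carries the energy.  The other two terms are the
    potentials of the integrations by parts that remove the Laplacian of v_3
    (second term) and the head from the term Q psi w (third term, vertical
    component only). *)
Let H j p : R := phi p * (work j p - head p * v j p) - psi p * (Psi p * D j 2 p)
  + (j == 2)%:R * (psi p * (head p * Psi p)).

Let h j p : R := psi p * hcoord j p * (work j p - head p * v j p)
  + phi p * (dwork j p - (dhead j p * v j p + head p * D j j p))
  - (chi p * hcoord j p * (Psi p * D j 2 p) + psi p * (dPsi j p * D j 2 p + Psi p * DD j 2 p))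
  + (j == 2)%:R * (chi p * hcoord j p * (head p * Psi p) +
     psi p * (dhead j p * Psi p + head p * dPsi j p)).

Let pd_H j : pd j (H j) (h j).
Proof.
apply: pd_eq.
  apply: pdD; first apply: pdD.
  - apply: pdM; first exact: pd_cut0.
    apply: pdD; first exact: pd_work.
    by apply: pdN; apply: pdM; [exact: pd_head|exact: pdv].
  - apply: pdN; apply: pdM; first exact: pd_cut1.
    by apply: pdM; [exact: pd_Psi|exact: pdDv].
  - apply: pdM; first exact: pd_cst.
    apply: pdM; first exact: pd_cut1.
    by apply: pdM; [exact: pd_head|exact: pd_Psi].
move=> p; rewrite /h /phi /psi /chi.
move: (cut0 a p) (cut1 a p) (cut2 a p) (hcoord j p) (work j p) (head p) (v j p)
  (dwork j p) (dhead j p) (D j j p) (Psi p) (D j 2 p) (dPsi j p) (DD j 2 p)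
  ((j == 2)%:R : R) => *; ring.
Qed.

Let cH j : continuous (H j).
Proof.
rewrite /H.
clearbody phi psi chi Psi dPsi head dhead work dwork.
repeat cont_step; cont_eta;
  first [exact cphi|exact cpsi|exact (@cwork _)|exact chead|exact (@cv _)|exact cPsi
    |exact (@cD _ _)].
Qed.

Let ch j : continuous (h j).
Proof.
rewrite /h.
clearbody phi psi chi Psi dPsi head dhead work dwork.
repeat cont_step; cont_eta;
  first [exact cphi|exact cpsi|exact cchi|exact (@continuous_hcoord _ _)
    |exact (@cwork _)|exact (@cdwork _)|exact chead|exact (@cdhead _)|exact (@cv _)
    |exact cPsi|exact (@cdPsi _)|exact (@cD _ _)|exact (@cDD _ _)].
Qed.

Let box_h j : boxX a (h j) = 0.
Proof.
apply: (boxX_pd a0 (@cH j) (@ch j) (@pd_H j)).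
  move=> j2 p pj; have b := bump_bnd a0 j2 pj.
  by rewrite /H /phi /psi /cut0 /cut1 b (negbTE j2) !expr0n/= !(mulr0, mul0r) subrr addr0.
move=> -> x y; rewrite /H Psi0 Psi1 /work /head !perv !perD !perq.
have e : phi (point3 x y 1) = phi (point3 x y 0) by rewrite /phi /cut0 /bump !point3_coord.
by rewrite e !(mulr0, mul0r).
Qed.

(** The coefficient of d_j v_i in phi |grad v|^2 - div H. *)
Let K j i p : R := - (psi p * hcoord j p * v i p)
  + (i == 2)%:R * (chi p * hcoord j p * Psi p + psi p * dPsi j p)
  - psi p * Psi p * ((j == 2)%:R * v i p - (i == 2)%:R * v j p).

Let sum_h p : h 0 p + h 1 p + h 2 p =
  phi p * gradsq p - \sum_(j < 3) \sum_(i < 3) K j i p * D j i p.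
Proof.
have e0 : dq 0 p = DD 0 0 p + DD 1 0 p + DD 2 0 p -
    (v 0 p * D 0 0 p + v 1 p * D 1 0 p + v 2 p * D 2 0 p).
  by have := ns 0 p; lra.
have e1 : dq 1 p = DD 0 1 p + DD 1 1 p + DD 2 1 p -
    (v 0 p * D 0 1 p + v 1 p * D 1 1 p + v 2 p * D 2 1 p).
  by have := ns 1 p; lra.
have e2 : dq 2 p = DD 0 2 p + DD 1 2 p + DD 2 2 p -
    (v 0 p * D 0 2 p + v 1 p * D 1 2 p + v 2 p * D 2 2 p).
  by have := ns 2 p; lra.
have e3 : D 2 2 p = - D 0 0 p - D 1 1 p by have := div p; lra.
rewrite !sum3 /gradsq !sum3 /h /K /dhead /dwork e0 e1 e2 /work /dPsi /hcoord /= e3.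
have -> : w p = p 0 0 * v 0 p + p 0 1 * v 1 p by [].
ring.
Qed.

Let M0 : 0 <= M. Proof. exact: le_trans (vM 0 0). Qed.

Let cgrad1 : continuous grad1. Proof. exact: continuous_grad1. Qed.
Let cgradsq : continuous gradsq. Proof. exact: continuous_gradsq. Qed.

Let gradmean x y := itg 0 1 (fun t => grad1 (point3 x y t)).

Let D_le j i p : `|D j i p| <= grad1 p. Proof. exact: le_grad1. Qed.

Let hcoord_le j x y z : `|x| <= a -> `|y| <= a -> `|hcoord j (point3 x y z)| <= a.
Proof.
move=> xa ya; rewrite /hcoord; move: j; apply: ord3P => /=; rewrite ?point3_coord//.
by rewrite normr0 ltW.
Qed.

Let w_le x y z : `|x| <= a -> `|y| <= a -> `|w (point3 x y z)| <= 2 * a * M.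
Proof.
move=> xa ya; rewrite /w /flux !point3_coord.
have -> : 2 * a * M = a * M + a * M by ring.
by apply: normD_le; exact: normM_le.
Qed.

Let Psi_le x y z : `|x| <= a -> `|y| <= a -> 0 <= z <= 1 ->
  `|Psi (point3 x y z)| <= 2 * a * M.
Proof.
move=> xa ya z01.
have -> : 2 * a * M = itg 0 1 (fun _ : R => 2 * a * M) by rewrite itg_cst ?ltr01// subr0 mulr1.
apply: (@zprim_le _ w (fun=> 2 * a * M)) => //; first exact: cont_cst.
by move=> t; exact: w_le.
Qed.

Let dPsi_le j x y z : `|x| <= a -> `|y| <= a -> 0 <= z <= 1 ->
  `|dPsi j (point3 x y z)| <= 2 * a * M + a * gradmean x y.
Proof.
move=> xa ya z01.
have g0 : 0 <= gradmean x y.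
  by apply: itg_ge0 => t _; exact: le_trans (D_le 0 0 _).
rewrite /dPsi; case: (altP (j =P 2)) => [_|j2].
  by rewrite (le_trans (w_le _ xa ya))// lerDl mulr_ge0// ltW.
have Ma : M <= a * M by apply: ler_peMl.
have e : 2 * a * M + a * gradmean x y = itg 0 1 (fun t => 2 * a * M + a * grad1 (point3 x y t)).
  have cz : continuous (fun t : R => grad1 (point3 x y t)).
    exact: (@cont3_z _ (fun x y z => grad1 (point3 x y z)) x y (cont3_point3 cgrad1)).
  rewrite itgD; [|exact: cont_cst|by apply: contM; [exact: cont_cst|]].
  by rewrite itg_cst ?ltr01// itgZ// subr0 mulr1.
rewrite e; apply: (@zprim_le _ (dflux v D j) (fun p => 2 * a * M + a * grad1 p)) => //.
  by apply: contD; [exact: cont_cst|apply: contM; [exact: cont_cst|]].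
move=> t; rewrite /dflux !point3_coord.
have -> : (j == 0)%:R * v 0 (point3 x y t) + x * D j 0 (point3 x y t) +
    ((j == 1)%:R * v 1 (point3 x y t) + y * D j 1 (point3 x y t)) =
  ((j == 0)%:R * v 0 (point3 x y t) + (j == 1)%:R * v 1 (point3 x y t)) +
  (x * D j 0 (point3 x y t) + y * D j 1 (point3 x y t)) by ring.
apply: normD_le.
  have -> : 2 * a * M = a * M + a * M by ring.
  apply: normD_le; apply: le_trans Ma; rewrite -[M]mul1r; apply: normM_le => //.
    by case: (j == 0); rewrite ?normr1 ?normr0.
  by case: (j == 1); rewrite ?normr1 ?normr0.
have hD : `|D j 0 (point3 x y t)| + `|D j 1 (point3 x y t)| <= grad1 (point3 x y t).
  rewrite /grad1 (bigD1 j)//= sum3 -!addrA lerD2l lerDl.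
  by rewrite addr_ge0//; apply: sumr_ge0 => k _; apply: sumr_ge0.
apply: le_trans (ler_wpM2l (ltW a0) hD); rewrite mulrDr.
by apply: normD_le; exact: normM_le.
Qed.

(** psi is O(1/a^2) and chi is O(1/a^4), while x_h, w and Psi are O(a) and dPsi
    is O(a) up to the vertical mean; as a >= 1, every product is O(1/a). *)
Let K_le j i x y z : `|x| <= a -> `|y| <= a -> 0 <= z <= 1 ->
  `|K j i (point3 x y z)| <= a^-1 * (66 * M + 24 * M ^+ 2 + 6 * gradmean x y).
Proof.
move=> xa ya z01; rewrite /K.
have an0 : a != 0 by exact: lt0r_neq0.
have d1 (b : bool) : `|b%:R : R| <= 1 by case: b; rewrite ?normr1 ?normr0.
have h1 := @norm_cut1 _ a a0 (point3 x y z); have h2 := @norm_cut2 _ a a0 (point3 x y z).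
have hc := hcoord_le j z xa ya.
have t1 : `|- (psi (point3 x y z) * hcoord j (point3 x y z) *
    v i (point3 x y z))| <= a^-1 * (6 * M).
  have -> : a^-1 * (6 * M) = 6 / a ^+ 2 * a * M by field.
  by rewrite normrN; apply: normM_le => //; exact: normM_le.
have t2 : `|(i == 2)%:R * (chi (point3 x y z) * hcoord j (point3 x y z) * Psi (point3 x y z) +
    psi (point3 x y z) * dPsi j (point3 x y z))| <=
    a^-1 * (48 * M) + a^-1 * (12 * M + 6 * gradmean x y).
  rewrite -[leRHS]mul1r; apply: normM_le; first exact: d1.
  apply: normD_le.
    apply: (@le_trans _ _ (24 / a ^+ 4 * a * (2 * a * M))).
      by apply: normM_le; [exact: normM_le|exact: Psi_le].
    have -> : 24 / a ^+ 4 * a * (2 * a * M) = a^-1 * (a^-1 * (48 * M)) by field.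
    rewrite ler_pM2l ?invr_gt0// ler_piMl//; first by rewrite mulr_ge0.
    by rewrite invf_le1.
  have -> : a^-1 * (12 * M + 6 * gradmean x y) =
    6 / a ^+ 2 * (2 * a * M + a * gradmean x y) by field.
  by apply: normM_le => //; exact: dPsi_le.
have t3 : `|- (psi (point3 x y z) * Psi (point3 x y z) * ((j == 2)%:R * v i (point3 x y z) -
    (i == 2)%:R * v j (point3 x y z)))| <= a^-1 * (24 * M ^+ 2).
  have -> : a^-1 * (24 * M ^+ 2) = 6 / a ^+ 2 * (2 * a * M) * (1 * M + 1 * M) by field.
  rewrite normrN; apply: normM_le; first by apply: normM_le => //; exact: Psi_le.
  by apply: normD_le; rewrite ?normrN; exact: normM_le.
apply: le_trans (normD_le (normD_le t1 t2) t3) _.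
by rewrite le_eqVlt; apply/orP; left; apply/eqP; ring.
Qed.

(** The fields H add up to a vector field with vanishing flux through the
    boundary of the box, and its divergence is phi |grad v|^2 minus the
    remainder estimated by [K_le]. *)
Lemma energy_le : boxX a (fun p => cut0 a p * gradsq p) <=
  a^-1 * ((66 * M + 24 * M ^+ 2) * boxX a grad1 + 6 * boxX a (fun p => grad1 p * grad1 p)).
Proof.
pose rem p := cut0 a p * gradsq p - (h 0 p + h 1 p + h 2 p).
have chs : continuous (fun p => h 0 p + h 1 p + h 2 p).
  by apply: contD; [apply: contD|]; exact: ch.
have cL : continuous (fun p => cut0 a p * gradsq p) by apply: contM; [exact: cphi|].
have crem : continuous rem by exact: contB.
have -> : boxX a (fun p => cut0 a p * gradsq p) = boxX a rem.
  have -> : (fun p => cut0 a p * gradsq p) = (fun p => (h 0 p + h 1 p + h 2 p) + rem p).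
    by apply/funext => p; rewrite /rem addrC subrK.
  have ch01 : continuous (fun p => h 0 p + h 1 p) by apply: contD; exact: ch.
  rewrite (boxXD a0 chs crem) (boxXD a0 ch01 (@ch 2)) (boxXD a0 (@ch 0) (@ch 1)).
  by rewrite !box_h !add0r.
pose C := 66 * M + 24 * M ^+ 2.
pose U1 x y z := (a^-1 * C) * grad1 (point3 x y z).
pose U2 x y z := (a^-1 * 6) * (grad1 (point3 x y z) * gradmean x y).
have cg3 := cont3_point3 cgrad1.
have cm : cont3 (fun x y z => grad1 (point3 x y z) * gradmean x y).
  apply: contM; first exact: cg3.
  apply: (@cont_fst_comp _ _ _ (fun p : R * R => gradmean p.1 p.2)).
  exact: (cont_itg1 cg3).
have cU1 : cont3 U1 by apply: contM; [exact: cont_cst|exact: cg3].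
have cU2 : cont3 U2 by apply: contM; [exact: cont_cst|exact: cm].
apply: (@le_trans _ _ (box a (fun x y z => U1 x y z + U2 x y z))).
  apply: le_box => //; [exact: cont3_point3|exact: contD|].
  move=> x y z xa ya z01; rewrite /rem sum_h opprB addrC subrK.
  have xa' : `|x| <= a by rewrite ler_norml.
  have ya' : `|y| <= a by rewrite ler_norml.
  apply: le_trans (ler_norm _) _.
  have -> : U1 x y z + U2 x y z = \sum_(j < 3) \sum_(i < 3)
      (a^-1 * (C + 6 * gradmean x y) * `|D j i (point3 x y z)|).
    under eq_bigr do rewrite -mulr_sumr.
    rewrite -mulr_sumr -/(grad1 _) /U1 /U2; ring.
  apply: le_trans (ler_norm_sum _ _ _) _; apply: ler_sum => j _.
  apply: le_trans (ler_norm_sum _ _ _) _; apply: ler_sum => i _.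
  by apply: normM_le => //; exact: K_le.
rewrite boxD// boxZ// /U2 boxZ//.
have := box_mean a0 cgrad1; rewrite -/gradmean => bm.
have a6 : 0 <= a^-1 * 6 by rewrite mulr_ge0// invr_ge0 ltW.
apply: le_trans (lerD (lexx _) (ler_wpM2l a6 bm)) _.
rewrite -[box a (fun x y z => grad1 (point3 x y z))]/(boxX a grad1) -/C.
move: (boxX a grad1) (boxX a _) => I1 I2.
by rewrite le_eqVlt; apply/orP; left; apply/eqP; ring.
Qed.

End radius.
End energy.

(** * Decay of the mean gradient *)

Section decay.
Context {R : realType}.
Local Notation X := 'rV[R]_3.
Implicit Types (p : X) (j : 'I_3) (a b c x y z t : R).

Lemma le_boxX a (F G : X -> R) : 0 < a -> continuous F -> continuous G ->
  (forall p, `|p 0 0| <= a -> `|p 0 1| <= a -> F p <= G p) -> boxX a F <= boxX a G.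
Proof.
move=> a0 cF cG FG; apply: le_box => //; try exact: cont3_point3.
by move=> x y z xa ya _; apply: FG; rewrite point3_coord ler_norml.
Qed.

Lemma boxX_subset a b (F : X -> R) : 0 < a <= b -> continuous F -> (forall p, 0 <= F p) ->
  boxX a F <= boxX b F.
Proof. by move=> ab cF F0; apply: box_subset => //; exact: cont3_point3. Qed.

(** The pointwise inequality G/a <= G^2/(4 mu) + mu/a^2 is integrated over the
    box of size a minus a fixed box of size b: the first term is controlled by
    the tail of the integral of G^2, the second one by 4 mu because the box has
    volume 4 a^2.  The part over the fixed box is O(1/a). *)
Lemma boxX_mean_decay (G : X -> R) (K : R) : continuous G -> (forall p, 0 <= G p) ->
  (forall a, 0 < a -> boxX a (fun p => G p * G p) <= K) ->
  forall e, 0 < e -> exists a0, forall a, a0 <= a -> 0 < a -> a^-1 * boxX a G <= e.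
Proof.
move=> cG G0 NK e e0.
have arith (u1 u2 u3 u4 u5 u6 : R) : u2 - u4 + u6 <= u1 - u3 + u5 ->
    u1 - u2 <= e / 4 -> u5 = e / 4 -> 0 <= u6 -> u4 <= e / 4 -> u3 <= e.
  by move=> *; lra.
pose N a := boxX a (fun p => G p * G p).
(* With this mu, each of the error terms c1 (N a - N b), c2 (4 a^2) and
   boxX b G / a is at most e / 4. *)
pose mu := e / 16; have mu0 : 0 < mu by rewrite divr_gt0.
have cGG : continuous (fun p => G p * G p) by exact: contM.
have [b b0 bP] : exists2 b, 0 < b & forall a, 0 < a -> N a - N b <= mu * e.
  have hs : has_sup (N @` [set a | 0 < a]).
    split; first by exists (N 1), 1 => //=; exact: ltr01.
    by exists K => _ [a /= a0 <-]; exact: NK.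
  have [_ [b b0 <-] bS] := sup_adherent (mulr_gt0 mu0 e0) hs.
  exists b => // a a0; rewrite lerBlDr.
  have : N a <= sup (N @` [set a | 0 < a]) by apply: ub_le_sup; [exact: (proj2 hs)|exists a].
  by move=> h; apply: (le_trans h); rewrite -lerBlDl ltW.
have T0 : 0 <= boxX b G by apply: box_ge0.
exists (b + 4 * boxX b G / e) => a ba a0.
have ba' : b <= a by apply: le_trans ba; rewrite lerDl divr_ge0 ?mulr_ge0// ltW.
have an0 : a != 0 by exact: lt0r_neq0.
have en0 : e != 0 by exact: lt0r_neq0.
pose c1 := (4 * mu)^-1; pose c2 := mu / a ^+ 2.
have cc1 : continuous (fun p => c1 * (G p * G p)) by apply: contM; [exact: cont_cst|].
have cc2 : continuous (fun p => - a^-1 * G p) by apply: contM; [exact: cont_cst|].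
have cc3 : continuous (fun p => c1 * (G p * G p) + - a^-1 * G p) by exact: contD.
have ck : continuous (fun _ : X => c2) by exact: cont_cst.
pose F p := (c1 * (G p * G p) + - a^-1 * G p) + c2.
have E t : 0 < t -> boxX t F = c1 * N t - a^-1 * boxX t G + c2 * (4 * t ^+ 2).
  move=> t0; rewrite /F boxXD// boxXD// boxXZ// boxXZ// mulNr.
  by rewrite {3}/boxX box_cst.
have F0 p : 0 <= F p.
  have -> : F p = c1 * (G p - 2 * mu * a^-1) ^+ 2.
    rewrite /F /c1 /c2; field; rewrite an0; exact: lt0r_neq0.
  by rewrite mulr_ge0 ?sqr_ge0// /c1 invr_ge0 mulr_ge0// ltW.
have cF : continuous F by exact: contD.
have := @boxX_subset b a F _ cF F0; rewrite b0 ba' => /(_ isT); rewrite !E// => H.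
have h1 : c1 * (N a - N b) <= e / 4.
  apply: (@le_trans _ _ (c1 * (mu * e))).
    by rewrite ler_wpM2l ?bP// /c1 invr_ge0 mulr_ge0// ltW.
  rewrite le_eqVlt; apply/orP; left; apply/eqP; rewrite /c1 /mu; field; exact: en0.
have h2 : c2 * (4 * a ^+ 2) = e / 4 by rewrite /c2 /mu; field.
have h3 : 0 <= c2 * (4 * b ^+ 2).
  by rewrite /c2; apply: mulr_ge0; [apply: divr_ge0; [exact: ltW|exact: sqr_ge0]|
    apply: mulr_ge0 => //; exact: sqr_ge0].
have h4 : a^-1 * boxX b G <= e / 4.
  rewrite mulrC ler_pdivrMr//.
  have : 4 * boxX b G / e <= a by apply: le_trans ba; rewrite lerDr ltW.
  rewrite ler_pdivrMr//; move: (boxX b G) => T hT.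
  by rewrite mulrAC ler_pdivlMr// mulrC [e * a]mulrC.
rewrite mulrBr in h1; exact: (arith _ _ _ _ _ _ H h1 h2 h3 h4).
Qed.

Lemma floor_fract (x : R) : exists (k : int) (t : R), x = t + k%:~R /\ 0 <= t < 1.
Proof.
exists (Num.floor x), (x - (Num.floor x)%:~R); split; first by rewrite subrK.
by have /andP[h1 h2] := floor_itv x; rewrite intrD in h2; apply/andP; split; lra.
Qed.

Lemma periodic_int (T : Type) (f : R -> T) : (forall t, f (t + 1) = f t) ->
  forall (t : R) (k : int), f (t + k%:~R) = f t.
Proof.
move=> per; have pn t (n : nat) : f (t + n%:R) = f t.
  by elim: n => [|n IH]; rewrite ?addr0// -natr1 addrA per.
move=> t [n|n]; first exact: pn.
by rewrite -(pn (t + (Negz n)%:~R) n.+1) NegzE mulrNz subrK.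
Qed.

Lemma continuous_eq0 (f : R -> R) : continuous f -> (forall t, 0 < t < 1 -> f t = 0) -> f 0 = 0.
Proof.
move=> cf f0.
have h1 : f t @[t --> 0^'+] --> f 0 by apply: cvg_at_right_filter; exact: cf.
have h2 : f t @[t --> 0^'+] --> (0 : R).
  apply: (@cvg_trans _ ((fun=> 0 : R) @ 0^'+)); last exact: cvg_cst.
  apply: near_eq_cvg; near=> t; rewrite f0//; apply/andP; split; near: t.
    exact: nbhs_right_gt.
  by apply: nbhs_right_lt; exact: ltr01.
exact: (cvg_unique _ h1 h2).
Unshelve. all: by end_near. Qed.

(** Vanishing is first obtained for 0 < z < 1; continuity adds z = 0 and
    periodicity the other z. *)
Lemma boxX_eq0 (F : X -> R) : continuous F -> (forall p, 0 <= F p) ->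
  (forall x y z, F (point3 x y (z + 1)) = F (point3 x y z)) ->
  (forall c, 0 < c -> boxX c F = 0) -> forall p, F p = 0.
Proof.
move=> cF F0 per b0 p; rewrite -(point3_eta p).
move: (p 0 0) (p 0 1) (p 0 2) => x y z.
have [k [t [-> /andP[t0 t1]]]] := floor_fract z.
rewrite (@periodic_int _ (fun z => F (point3 x y z)) (per x y)).
have H s : 0 < s < 1 -> F (point3 x y s) = 0.
  pose c := `|x| + `|y| + 1.
  have c0 : 0 < c by rewrite ltr_wpDl.
  have xc : - c < x < c by rewrite -ltr_norml /c -addrA ltrDl ltr_wpDl.
  have yc : - c < y < c by rewrite -ltr_norml /c -addrA addrCA ltrDl ltr_wpDl.
  exact: (box_eq0 c0 (cont3_point3 cF) (fun x y z => F0 _) (b0 _ c0)).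
move: t0; rewrite le_eqVlt => /predU1P[<-|t0]; last by apply: H; rewrite t0.
apply: continuous_eq0 H.
exact: (@cont3_z _ (fun x y z => F (point3 x y z)) x y (cont3_point3 cF)).
Qed.

Lemma pd0_cst (F : X -> R) : (forall j, pd j F (fun=> 0)) -> forall p, F p = F 0.
Proof.
move=> dF p; rewrite -(point3_eta p) -[in RHS](point3_eta 0) !mxE.
move: (p 0 0) (p 0 1) (p 0 2) => x y z.
rewrite (is_derive_0_is_cst x 0 (fun x => pd_x x y z (dF 0))).
rewrite (is_derive_0_is_cst y 0 (fun y => pd_y 0 y z (dF 1))).
exact: (is_derive_0_is_cst z 0 (fun z => pd_z 0 0 z (dF 2))).
Qed.

End decay.

(** * Axial symmetry and coordinates of vector fields *)

Section bridge.
Context {R : realType}.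
Local Notation X := 'rV[R]_3.
Implicit Types (p : X) (i j : 'I_3) (a b c x y z t : R).

Lemma pd_partial j (f : X -> X) i : (forall p, derivable f p (basis3 R j)) ->
  pd j (fun p => f p 0 i) (fun p => partial j f p 0 i).
Proof.
move=> df p; apply: DeriveDef; first exact: (derivable_mxP _ _ _).1.
by rewrite /partial derive_mx// mxE.
Qed.

Lemma pd_partial1 j (f : X -> R) : (forall p, derivable f p (basis3 R j)) ->
  pd j f (partial j f).
Proof. by move=> df p; exact: DeriveDef. Qed.

Lemma cont_entry (f : X -> X) i : continuous f -> continuous (fun p => f p 0 i).
Proof. by move=> cf; apply: (cont_comp (@cont_coord _ i) cf). Qed.

Lemma entry_le p i : `|p 0 i| <= `|p|.
Proof.
rewrite [leRHS]/Num.Def.normr/= mx_normrE.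
exact: (le_bigmax _ (fun ij => `|p ij.1 ij.2|) (0, i)).
Qed.

Lemma add_basis3_2 x y z : point3 x y z + basis3 R 2 = point3 x y (z + 1).
Proof. by have := line_point3 2 x y z 1; rewrite scale1r /= !mulr0 !addr0 mulr1. Qed.

Lemma partial_periodic (f : X -> X) j : periodic_x3 f -> periodic_x3 (partial j f).
Proof.
move=> pf p; rewrite /partial /derive.
have -> // : (fun h : R => h^-1 *: ((f \o shift (p + basis3 R 2)) (h *: basis3 R j) -
    f (p + basis3 R 2))) = (fun h : R => h^-1 *: ((f \o shift p) (h *: basis3 R j) - f p)).
by apply/funext => h /=; rewrite pf addrA pf.
Qed.

Lemma polar x y : 0 < x ^+ 2 + y ^+ 2 -> exists r t, [/\ 0 < r, x = r * cos t & y = r * sin t].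
Proof.
move=> xy0; pose r := Num.sqrt (x ^+ 2 + y ^+ 2).
have r0 : 0 < r by rewrite sqrtr_gt0.
have r2 : r ^+ 2 = x ^+ 2 + y ^+ 2 by rewrite sqr_sqrtr// ltW.
have rn0 : r != 0 by exact: lt0r_neq0.
have xr : -1 <= x / r <= 1.
  rewrite -ler_norml normf_div (gtr0_norm r0) ler_pdivrMr// mul1r.
  by rewrite -sqrtr_sqr ler_wsqrtr// lerDl sqr_ge0.
have s : Num.sqrt (1 - (x / r) ^+ 2) = `|y| / r.
  have -> : 1 - (x / r) ^+ 2 = (`|y| / r) ^+ 2.
    rewrite !exprMn real_normK ?num_real// exprVn r2; field.
    by apply: lt0r_neq0.
  by rewrite sqrtr_sqr ger0_norm// divr_ge0// ltW.
have cx : x = r * cos (acos (x / r)) by rewrite acosK ?in_itv//= mulrC divfK.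
have sy : r * sin (acos (x / r)) = `|y|.
  by rewrite sin_acos// s mulrC divfK.
have [y0|y0] := lerP 0 y.
  by exists r, (acos (x / r)); split => //; rewrite sy ger0_norm.
by exists r, (- acos (x / r)); split => //; rewrite ?cosN// sinN mulrN sy ltr0_norm// opprK.
Qed.

Lemma angular_polar (f : X -> X) r t z : 0 < r ->
  r * angular_component f (point3 (r * cos t) (r * sin t) z) =
  - (r * sin t) * f (point3 (r * cos t) (r * sin t) z) 0 0 +
  (r * cos t) * f (point3 (r * cos t) (r * sin t) z) 0 1.
Proof.
move=> r0; have rn0 : r != 0 by exact: lt0r_neq0.
have rE : cyl_radius (point3 (r * cos t) (r * sin t) z) = r.
  rewrite /cyl_radius !point3_coord !exprMn -mulrDr cos2Dsin2 mulr1.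
  by rewrite sqrtr_sqr gtr0_norm.
rewrite /angular_component sum3 /e_theta rE !point3_coord; field.
exact: rn0.
Qed.

(** The symmetry of r v_theta = - x_2 v_1 + x_1 v_2 is differentiated along
    circles. *)
Lemma axisym_rot (f : X -> X) (D : 'I_3 -> 'I_3 -> X -> R) :
  (forall i, continuous (fun p => f p 0 i)) -> (forall j i, continuous (D j i)) ->
  (forall j i, pd j (fun p => f p 0 i) (D j i)) ->
  axially_symmetric (angular_component f) -> forall p : X,
  p 0 0 * (- f p 0 0 - p 0 1 * D 1 0 p + p 0 0 * D 1 1 p) =
  p 0 1 * (- p 0 1 * D 0 0 p + f p 0 1 + p 0 0 * D 0 1 p).
Proof.
move=> cf cD df ax p; rewrite -(point3_eta p) !point3_coord.
move: (p 0 0) (p 0 1) (p 0 2) => x y z.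
have [xy0|] := ltP 0 (x ^+ 2 + y ^+ 2); last first.
  move=> xy0; have x2 := sqr_ge0 x; have y2 := sqr_ge0 y.
  have /eqP : x ^+ 2 = 0 by apply/le_anti; rewrite x2 andbT; lra.
  have /eqP : y ^+ 2 = 0 by apply/le_anti; rewrite y2 andbT; lra.
  by rewrite !sqrf_eq0 => /eqP -> /eqP ->; rewrite !mul0r.
have [r [t [r0 xE yE]]] := polar xy0.
pose F (x y : R) := - y * f (point3 x y z) 0 0 + x * f (point3 x y z) 0 1.
pose F1 (x y : R) := - y * D 0 0 (point3 x y z) + (f (point3 x y z) 0 1 + x * D 0 1 (point3 x y z)).
pose F2 (x y : R) := (- f (point3 x y z) 0 0 - y * D 1 0 (point3 x y z)) + x * D 1 1 (point3 x y z).
have d1 (u u' : R) : is_derive u (1 : R) (F^~ u') (F1 u u').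
  have h0 := pd_x u u' z (df 0 0); have h1 := pd_x u u' z (df 0 1).
  apply: is_derive_eq; rewrite /F1 /GRing.scale/=; ring.
have d2 (u u' : R) : is_derive u' (1 : R) (F u) (F2 u u').
  have h0 := pd_y u u' z (df 1 0); have h1 := pd_y u u' z (df 1 1).
  apply: is_derive_eq; rewrite /F2 /GRing.scale/=; ring.
have cpt (g : X -> R) : continuous g -> continuous (fun p : R * R => g (point3 p.1 p.2 z)).
  move=> cg; apply: (cont_comp cg).
  by apply: continuous_point3; [exact: cont_fst|exact: cont_snd|exact: cont_cst].
have c1 : continuous (fun p : R * R => F1 p.1 p.2).
  apply: contD; first apply: contM; first by apply: contN; exact: cont_snd.
    exact: (cpt _ (cD 0 0)).
  apply: contD; first exact: (cpt _ (cf 1)).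
  by apply: contM; [exact: cont_fst|exact: (cpt _ (cD 0 1))].
have c2 : continuous (fun p : R * R => F2 p.1 p.2).
  apply: contD; first apply: contB.
  - by apply: contN; exact: (cpt _ (cf 0)).
  - by apply: contM; [exact: cont_snd|exact: (cpt _ (cD 1 0))].
  - by apply: contM; [exact: cont_fst|exact: (cpt _ (cD 1 1))].
have dc : is_derive t (1 : R) (fun s => r * cos s) (- (r * sin t)).
  by apply: is_derive_eq; rewrite /GRing.scale/=; ring.
have ds : is_derive t (1 : R) (fun s => r * sin s) (r * cos t).
  by apply: is_derive_eq; rewrite /GRing.scale/=; ring.
have := is_derive_chain2 d1 d2 c1 c2 dc ds.
have -> : (fun s => F (r * cos s) (r * sin s)) =
    (fun _ : R => r * angular_component f (point3 (r * cos 0) (r * sin 0) z)).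
  by apply/funext => s; rewrite /F -angular_polar// (ax r s 0 z r0).
move=> [_ e0]; rewrite derive_cst -xE -yE /F1 /F2 in e0.
lra.
Qed.

End bridge.

(** * The Liouville theorem *)

Lemma row_combination_eq0 (R : realType) (u : 'I_3 -> R) (a b c d e f : 'rV[R]_3)
    (g : 'I_3 -> R) i :
  u 0 *: a + u 1 *: b + u 2 *: c + (\row_(k < 3) g k) - (d + e + f) = 0 ->
  u 0 * a 0 i + u 1 * b 0 i + u 2 * c 0 i + g i - (d 0 i + e 0 i + f 0 i) = 0.
Proof. by move=> /rowP/(_ i); rewrite !mxE. Qed.

(** The factor 8 is the inverse of the lower bound of the cut-off on the smaller
    box; each of the two error terms may then be as large as e / 16. *)
Lemma absorb_error (R : realType) (C K e a m n s t r : R) :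
  0 <= C -> 0 < e -> 0 < a -> 0 <= m ->
  a^-1 * m <= e / (16 * (C + 1)) -> n <= 9 * K -> 864 * K / e <= a ->
  s <= 8 * t -> t <= r -> r <= a^-1 * (C * m + 6 * n) -> s <= e.
Proof.
move=> C0 e0 a0 m0 hm hn ha st tr hr.
have C1 : C + 1 != 0 by rewrite gt_eqF// ltr_wpDl.
have h1 : C * (a^-1 * m) <= e / 16.
  apply: (@le_trans _ _ ((C + 1) * (e / (16 * (C + 1))))).
    by apply: ler_pM => //; [rewrite mulr_ge0// invr_ge0 ltW|rewrite lerDl].
  by rewrite le_eqVlt; apply/orP; left; apply/eqP; field.
have h2 : a^-1 * (6 * n) <= e / 16.
  rewrite mulrC ler_pdivrMr//.
  have : 864 * K <= a * e by rewrite -ler_pdivrMr.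
  lra.
have h3 : a^-1 * (C * m + 6 * n) = C * (a^-1 * m) + a^-1 * (6 * n) by ring.
rewrite h3 in hr; lra.
Qed.

Theorem theorem4p20 (R : realType) (v : 'rV[R]_3 -> 'rV[R]_3)
    (P : 'rV[R]_3 -> R)
    (v_smooth : smooth v) (P_smooth : smooth P)
    (v_periodic : periodic_x3 v) (P_periodic : periodic_x3 P)
    (v_bounded : exists M : R, forall x : 'rV[R]_3, `|v x| <= M)
    (NS : stationary_NS v P)
    (finite_dirichlet : (dirichlet_integral v < +oo)%E)
    (v_theta_axisym : axially_symmetric (angular_component v)) :
  exists c : R, forall x : 'rV[R]_3, v x = c *: basis3 R 2.
Proof.
have [M vM] := v_bounded.
pose u i (p : 'rV[R]_3) : R := v p 0 i.
pose D j i (p : 'rV[R]_3) : R := partial j v p 0 i.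
pose DD j i (p : 'rV[R]_3) : R := partial j (partial j v) p 0 i.
have cu i : continuous (u i) by exact: cont_entry (v_smooth [::]).1.
have cD j i : continuous (D j i) by exact: cont_entry (v_smooth [:: j]).1.
have cDD j i : continuous (DD j i) by exact: cont_entry (v_smooth [:: j; j]).1.
have cP : continuous P := (P_smooth [::]).1.
have cdP j : continuous (partial j P) := (P_smooth [:: j]).1.
have du j i : pd j (u i) (D j i) by apply: pd_partial; exact: (v_smooth [::]).2.
have dD j i : pd j (D j i) (DD j i) by apply: pd_partial; exact: (v_smooth [:: j]).2.
have dP j : pd j P (partial j P) by apply: pd_partial1; exact: (P_smooth [::]).2.
have div p : D 0 0 p + D 1 1 p + D 2 2 p = 0.
  by have [_] := NS p; rewrite /divergence sum3.
have ns i p : u 0 p * D 0 i p + u 1 p * D 1 i p + u 2 p * D 2 i p + partial i P p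
    - (DD 0 i p + DD 1 i p + DD 2 i p) = 0.
  have [+ _] := NS p.
  rewrite /convection /laplacian !sum3 /gradient => h.
  exact: (row_combination_eq0 (u := fun k => v p 0 k) i h).
have per_u i x y z : u i (point3 x y (z + 1)) = u i (point3 x y z).
  by rewrite /u -add_basis3_2 v_periodic.
have per_D j i x y z : D j i (point3 x y (z + 1)) = D j i (point3 x y z).
  by rewrite /D -add_basis3_2 (partial_periodic _ v_periodic).
have per_P x y : P (point3 x y 1) = P (point3 x y 0).
  by rewrite -[1 in LHS]add0r -add_basis3_2 P_periodic.
have uM i p : `|u i p| <= M by apply: le_trans (entry_le _ _) (vM p).
have rot := axisym_rot cu cD du v_theta_axisym.
pose G := grad1 D; pose S := gradsq D.
have cG : continuous G by exact: continuous_grad1.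
have cS : continuous S by exact: continuous_gradsq.
have G0 p : 0 <= G p by exact: grad1_ge0.
have S0 p : 0 <= S p by exact: gradsq_ge0.
pose Dir := fine (dirichlet_integral v).
have SK a : 0 < a -> boxX a S <= Dir.
  move=> a0.
  have E : dirichlet_integral v = (\int[@lebesgue3 R]_(y in [set: R * R] `*` `[0%R, 1%R])
     (S (point3 y.1.1 y.1.2 y.2))%:E)%E.
    apply: eq_integral => y _; congr (_%:E).
    rewrite /S /gradsq /grad_normsq exchange_big/=.
    by apply: eq_bigr => i _; apply: eq_bigr => j _; rewrite expr2.
  have Efin : dirichlet_integral v \is a fin_num.
    rewrite ge0_fin_numE; first exact: finite_dirichlet.
    by rewrite E; apply: integral_ge0 => y _; rewrite lee_fin.
  have DE : Dir%:E = dirichlet_integral v by rewrite /Dir fineK.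
  rewrite -lee_fin DE E.
  exact: (box_le_lebesgue3 a0 (cont3_point3 cS) (fun x y z => S0 _)).
have cGG : continuous (fun p => G p * G p) by exact: contM.
have GK a : 0 < a -> boxX a (fun p => G p * G p) <= 9 * Dir.
  move=> a0; apply: (@le_trans _ _ (boxX a (fun p => 9 * S p))).
    apply: le_boxX => //; first by apply: contM => //; exact: cont_cst.
    by move=> p _ _; exact: sqr_grad1_le.
  by rewrite boxXZ// ler_wpM2l// SK.
have M0 : 0 <= M by apply: le_trans (uM 0 0).
pose C := 66 * M + 24 * M ^+ 2.
have C0 : 0 <= C by rewrite addr_ge0 ?mulr_ge0 ?exprn_ge0.
have en a : 1 <= a -> boxX a (fun p => cut0 a p * S p) <=
    a^-1 * (C * boxX a G + 6 * boxX a (fun p => G p * G p)).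
  have u01 i x y : u i (point3 x y 1) = u i (point3 x y 0).
    by have := per_u i x y 0; rewrite add0r.
  have D01 j i x y : D j i (point3 x y 1) = D j i (point3 x y 0).
    by have := per_D j i x y 0; rewrite add0r.
  exact: (energy_le cu cD cDD cP cdP du dD dP div ns u01 D01 per_P uM rot).
have Dir0 : 0 <= Dir by apply: le_trans (SK 1 ltr01); exact: box_ge0.
have box0 c : 0 < c -> boxX c S = 0.
  move=> c0; apply/le_anti/andP; split; last exact: box_ge0.
  apply/ler_addgt0Pr => e e0; rewrite add0r.
  have k0 : 0 < e / (16 * (C + 1)) by rewrite divr_gt0// mulr_gt0// ltr_wpDl.
  have [a1 a1P] := boxX_mean_decay cG G0 GK k0.
  (* 864 = 16 * 6 * 9: Cauchy-Schwarz over the nine derivatives gives the 9. *)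
  pose a := Num.max a1 (Num.max 1 (Num.max (c *+ 2) (864 * Dir / e))).
  have ha1 : a1 <= a by rewrite le_max lexx.
  have ha2 : 1 <= a by rewrite !le_max lexx orbT.
  have ha3 : c *+ 2 <= a by rewrite !le_max lexx !orbT.
  have ha4 : 864 * Dir / e <= a by rewrite !le_max lexx !orbT.
  have a0 : 0 < a by exact: lt_le_trans ha2.
  have ca : c <= a by apply: le_trans ha3; rewrite mulr2n lerDl ltW.
  have ccS : continuous (fun p => cut0 a p * S p).
    by apply: contM => //; exact: continuous_cut0.
  have cS0 p : 0 <= cut0 a p * S p.
    by apply: mulr_ge0 => //; case/andP: (cut0_le1 a p).
  have s1 : boxX c S <= 8 * boxX c (fun p => cut0 a p * S p).
    rewrite -(boxXZ 8 c0 ccS); apply: le_boxX => //.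
      by apply: contM; [exact: cont_cst|].
    move=> p px py; have := cut0_ge a0 c0 ha3 px py => h.
    by rewrite mulrA ler_peMl// -(@ler_pM2l _ 8^-1) ?invr_gt0// mulKf// mulr1 -[8^-1]mul1r.
  have s2 : boxX c (fun p => cut0 a p * S p) <= boxX a (fun p => cut0 a p * S p).
    by apply: boxX_subset => //; rewrite c0.
  have s3 := en a ha2.
  have s4 := a1P a ha1 a0.
  have s5 := GK a a0.
  have TG0 : 0 <= boxX a G by exact: box_ge0.
  exact: (absorb_error C0 e0 a0 TG0 s4 s5 ha4 s1 s2 s3).
have perS x y z : S (point3 x y (z + 1)) = S (point3 x y z).
  by apply: eq_bigr => j _; apply: eq_bigr => i _; rewrite per_D.
have Sz := boxX_eq0 cS S0 perS box0.
have Dz j i p : D j i p = 0 by exact: (gradsq_eq0 (Sz p)).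
have uc i p : u i p = u i 0.
  by apply: (@pd0_cst _ (u i)) => j q; rewrite -(Dz j i q); exact: du.
have ang t : angular_component v (point3 (1 * cos t) (1 * sin t) 0) =
    - sin t * u 0 0 + cos t * u 1 0.
  by rewrite -[LHS]mul1r angular_polar ?ltr01// -/(u _ _) -/(u _ _) !uc !mul1r.
have u1 : u 1 0 = 0.
  have := v_theta_axisym 1 0 pi 0 ltr01; rewrite !ang sin0 cos0 sinpi cospi; lra.
have u0 : u 0 0 = 0.
  have := v_theta_axisym 1 (pi / 2) (- (pi / 2)) 0 ltr01.
  by rewrite !ang sinN cosN sin_pihalf cos_pihalf; lra.
exists (u 2 0) => p; apply/rowP => i; rewrite !mxE eqxx /= -[v p 0 i]/(u i p) uc.
by move: i; apply: ord3P => /=; rewrite ?u0 ?u1 ?mulr0 ?mulr1.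
Qed.
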